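(* Let $F_A$ be the free group with finite basis $A$. The doubly generalized conjugacy problem with rational constraints is decidable with respect to rational subsets of $F_A$; that is, there is an algorithm which, on input rational subsets $K_0,K_1,K_2$ of $F_A$, decides whether there exist $u\in K_0$, $x_1\in K_1$ and $x_2\in K_2$ such that $x_1=u^{-1}x_2u$.
   Context: Let $\widetilde A=A\cup A^{-1}$ and let $\pi:\widetilde A^*\to F_A$ be the canonical surjective monoid homomorphism. A subset $K\subseteq F_A$ is rational if $K=L\pi$ for some rational (regular) language $L\subseteq\widetilde A^*$. A rational subset is given as input by a finite state automaton recognizing a language $L\subseteq\widetilde A^*$ with $L\pi=K$. *)

(* Defs.v *)
From HB Require Import structures.
From mathcomp Require Import all_boot.

Set Implicit Arguments.
Unset Strict Implicit.
Unset Printing Implicit Defensive.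

Local Open Scope group_scope.

(* (a, false) stands for the letter a and (a, true) for its formal inverse. *)
Notation letter A := (A * bool)%type.

Definition linv (A : finType) (x : letter A) : letter A := (x.1, ~~ x.2).

Definition reduced (A : finType) (w : seq (letter A)) : bool :=
  sorted (fun x y => y != linv x) w.

(* Left multiplication of a reduced word by a letter, with cancellation. *)
Definition push (A : finType) (x : letter A) (w : seq (letter A)) :=
  if w is y :: w' then if y == linv x then w' else x :: w else [:: x].

Definition reduce (A : finType) (w : seq (letter A)) := foldr (@push A) [::] w.

(* F_A: the reduced words, multiplied by concatenation and reduction. *)
Record freegroup (A : finType) : Type :=
  FreeGroup { fgword :> seq (letter A); fgwordP : reduced fgword }.
HB.instance Definition _ (A : finType) := [isSub for @fgword A].
HB.instance Definition _ (A : finType) := [Choice of freegroup A by <:].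

Section FreeGroup.

Variable A : finType.
Implicit Types (x y : letter A) (u v w : seq (letter A)).

Lemma linvK : involutive (@linv A).
Proof. by case=> a b; rewrite /linv /= negbK. Qed.

Lemma push_reduced x w : reduced w -> reduced (push x w).
Proof.
case: w => [|y w] //=; case: ifP => [_ /path_sorted //|neq_yx pw].
by rewrite /reduced /= neq_yx.
Qed.

Lemma foldr_push_reduced u w : reduced w -> reduced (foldr (@push A) w u).
Proof. by elim: u => //= x u IHu /IHu; apply: push_reduced. Qed.

Lemma reduce_reduced w : reduced (reduce w).
Proof. exact: foldr_push_reduced. Qed.

Lemma pushK x w : reduced w -> push x (push (linv x) w) = w.
Proof.
case: w => [|y w] /=; first by rewrite eqxx.
rewrite linvK; case: (eqVneq y x) => [->|neq_yx] rw /=; last by rewrite eqxx.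
by case: w rw => [|z w] //= /andP[/negPf-> _].
Qed.

Lemma reduce_id w : reduced w -> reduce w = w.
Proof.
elim: w => //= x w IHw rw; have /IHw {IHw} := path_sorted rw.
rewrite /reduce /= => ->; case: w rw => //= y w.
by rewrite /reduced /= => /andP[/negPf->].
Qed.

Lemma foldr_push_push x w u : reduced w ->
  foldr (@push A) w (push x u) = push x (foldr (@push A) w u).
Proof.
move=> rw; case: u => [|y u] //=; case: eqP => [->|] //=.
by rewrite pushK // foldr_push_reduced.
Qed.

Lemma foldr_push_reduce u w : reduced w ->
  foldr (@push A) w (reduce u) = foldr (@push A) w u.
Proof. by move=> rw; elim: u => //= x u IHu; rewrite foldr_push_push ?IHu. Qed.

Lemma reduce_cat u w : reduce (u ++ w) = foldr (@push A) (reduce w) u.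
Proof. exact: foldr_cat. Qed.

Lemma reduce_catl u w : reduce (reduce u ++ w) = reduce (u ++ w).
Proof. by rewrite !reduce_cat foldr_push_reduce // reduce_reduced. Qed.

Lemma reduce_catr u w : reduce (u ++ reduce w) = reduce (u ++ w).
Proof. by rewrite !reduce_cat (reduce_id (reduce_reduced w)). Qed.

Definition winv w := rev (map (@linv A) w).

Lemma winvK : involutive winv.
Proof. by move=> w; rewrite /winv map_rev revK mapK //; apply: linvK. Qed.

Lemma reduce_winvr w : reduce (w ++ winv w) = [::].
Proof.
elim: w => //= x w IHw; rewrite -/(reduce _) /winv map_cons rev_cons -/(winv w).
rewrite -cats1 catA reduce_cat -foldr_push_reduce ?reduce_reduced // IHw /=.
by rewrite eqxx.
Qed.

(* The homomorphism pi; fgprojK gives its surjectivity. *)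
Definition fgproj w : freegroup A := FreeGroup (reduce_reduced w).

Definition fg_mul (g h : freegroup A) := fgproj (g ++ h).
Definition fg_one := fgproj [::].
Definition fg_inv (g : freegroup A) := fgproj (winv g).

Lemma fg_mulA : associative fg_mul.
Proof.
by move=> f g h; apply: val_inj; rewrite /= reduce_catr reduce_catl catA.
Qed.

Lemma fg_mul1 : left_id fg_one fg_mul.
Proof. by move=> g; apply: val_inj; rewrite /= reduce_id ?fgwordP. Qed.

Lemma fg_1mul : right_id fg_one fg_mul.
Proof. by move=> g; apply: val_inj; rewrite /= cats0 reduce_id ?fgwordP. Qed.

Lemma fg_mulV : left_inverse fg_one fg_inv fg_mul.
Proof.
move=> g; apply: val_inj; rewrite /= reduce_catl.
by rewrite -[X in _ ++ X]winvK reduce_winvr.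
Qed.

Lemma fg_Vmul : right_inverse fg_one fg_inv fg_mul.
Proof. by move=> g; apply: val_inj; rewrite /= reduce_catr reduce_winvr. Qed.

HB.instance Definition _ :=
  isGroup.Build (freegroup A) fg_mulA fg_mul1 fg_1mul fg_mulV fg_Vmul.

Definition fggen (a : A) : freegroup A := fgproj [:: (a, false)].

Lemma fgproj_nil : fgproj [::] = 1.
Proof. by []. Qed.

Lemma fgproj_cat u w : fgproj (u ++ w) = fgproj u * fgproj w.
Proof. by apply: val_inj; rewrite /= reduce_catl reduce_catr. Qed.

Lemma fgproj_letter (a : A) (b : bool) :
  fgproj [:: (a, b)] = if b then (fggen a)^-1 else fggen a.
Proof. by case: b; apply: val_inj. Qed.

Lemma fgprojK (g : freegroup A) : fgproj g = g.
Proof. by apply: val_inj; rewrite /= reduce_id ?fgwordP. Qed.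

Lemma freegroup_universal (G : groupType) (f : A -> G) :
  exists2 phi : freegroup A -> G,
    {morph phi : g h / g * h} /\ (forall a, phi (fggen a) = f a)
  & forall psi : freegroup A -> G, {morph psi : g h / g * h} ->
      (forall a, psi (fggen a) = f a) -> psi =1 phi.
Proof.
pose fl (x : letter A) : G := if x.2 then (f x.1)^-1 else f x.1.
pose fw w : G := foldr (fun x g => fl x * g) 1 w.
have flV x : fl x * fl (linv x) = 1.
  by case: x => a [] /=; rewrite /fl /= ?mulgV ?mulVg.
have fw_push x w : fw (push x w) = fl x * fw w.
  case: w => //= y w; case: eqP => //= ->; by rewrite mulgA flV mul1g.
have fw_red w : fw (reduce w) = fw w.
  by elim: w => //= x w IHw; rewrite fw_push IHw.
have fw_cat u w : fw (u ++ w) = fw u * fw w.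
  by elim: u => [|x u IHu] /=; rewrite ?mul1g // IHu mulgA.
exists (fun g => fw g).
  by split=> [g h|a] /=; [rewrite fw_red fw_cat | rewrite mulg1].
move=> psi psiM psif g.
have psi1 : psi 1 = 1 by apply: (mulgI (psi 1)); rewrite -psiM !mulg1.
have psiV h : psi h^-1 = (psi h)^-1.
  by apply: (mulgI (psi h)); rewrite -psiM !mulgV.
rewrite -[in LHS](fgprojK g); elim: (fgword g) => [|[a b] w IHw] /=.
  by rewrite -psi1.
rewrite -cat1s fgproj_cat psiM IHw fgproj_letter; congr (_ * _).
by case: b; rewrite ?psiV psif.
Qed.

End FreeGroup.

(* Nondeterministic finite automata; states are named by natural numbers, and
   the finite state set consists of the names that occur in the three lists. *)
Record fsa (A : finType) : Type := FSA {
  fsa_init : seq nat;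
  fsa_final : seq nat;
  fsa_trans : seq (nat * letter A * nat) }.

Definition fsa_tuple (A : finType) (M : fsa A) :=
  (fsa_init M, fsa_final M, fsa_trans M).
Definition tuple_fsa (A : finType)
    (t : seq nat * seq nat * seq (nat * letter A * nat)) :=
  FSA t.1.1 t.1.2 t.2.

Lemma fsa_tupleK (A : finType) : cancel (@fsa_tuple A) (@tuple_fsa A).
Proof. by case. Qed.

HB.instance Definition _ (A : finType) :=
  Countable.copy (fsa A) (can_type (@fsa_tupleK A)).

Fixpoint fsa_accepts_from (A : finType) (M : fsa A) (p : nat)
    (w : seq (letter A)) : Prop :=
  if w is x :: w' then
    exists2 q, (p, x, q) \in fsa_trans M & fsa_accepts_from M q w'
  else p \in fsa_final M.

Definition fsa_lang (A : finType) (M : fsa A) (w : seq (letter A)) : Prop :=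
  exists2 p, p \in fsa_init M & fsa_accepts_from M p w.

Definition rational_subset (A : finType) (M : fsa A) (g : freegroup A) : Prop :=
  exists2 w, fsa_lang M w & fgproj w = g.

Definition gen_conjugate (G : groupType) (K0 K1 K2 : G -> Prop) : Prop :=
  exists u x1 x2 : G, [/\ K0 u, K1 x1, K2 x2 & x1 = u^-1 * x2 * u].

(* Kleene's partial recursive functions, by number of arguments. *)
Inductive recf : nat -> Type :=
| RZero n : recf n
| RSucc : recf 1
| RProj n (i : 'I_n) : recf n
| RComp m n (f : recf m) (g : 'I_m -> recf n) : recf n
| RRec n (f : recf n) (g : recf n.+2) : recf n.+1
| RMin n (f : recf n.+1) : recf n.

(* The graph of primitive recursion: the recursion argument is [k], and the
   step receives [k], the previous value and the parameters, in this order. *)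
Fixpoint rec_graph n (F : n.-tuple nat -> nat -> Prop)
    (G : n.+2.-tuple nat -> nat -> Prop) (v : n.-tuple nat) (k y : nat) : Prop :=
  if k is j.+1 then exists2 z, rec_graph F G v j z & G [tuple of j :: z :: v] y
  else F v y.

(* [reval f v y]: the computation of [f] on [v] halts with value [y]. *)
Fixpoint reval n (f : recf n) : n.-tuple nat -> nat -> Prop :=
  match f in recf n return n.-tuple nat -> nat -> Prop with
  | RZero _ => fun _ y => y = 0%N
  | RSucc => fun v y => y = (thead v).+1
  | RProj _ i => fun v y => y = tnth v i
  | RComp m _ f g => fun v y =>
      exists2 w : m.-tuple nat, forall i, reval (g i) v (tnth w i) & reval f w y
  | RRec _ f g => fun v y =>
      rec_graph (reval f) (reval g) [tuple of behead v] (thead v) y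
  | RMin _ f => fun v y =>
      reval f [tuple of y :: v] 0%N /\
      forall z, (z < y)%N -> exists t, reval f [tuple of z :: v] t.+1
  end.

Lemma reval_functional n (f : recf n) v y z :
  reval f v y -> reval f v z -> y = z.
Proof.
elim: f v y z => {n} [n|||m n f IHf g IHg|n f IHf g IHg|n f IHf] /=.
- by move=> v y z -> ->.
- by move=> v y z -> ->.
- by move=> n i v y z -> ->.
- move=> v y z [w1 gw1 fw1] [w2 gw2 fw2].
  suff eq_w : w1 = w2 by rewrite -eq_w in fw2; apply: IHf fw1 fw2.
  by apply: eq_from_tnth => i; apply: IHg (gw1 i) (gw2 i).
- move=> v; elim: (thead v) => [|k IHk] y z /=; first exact: IHf.
  move=> [y' /IHk ey gy] [z' fz gz]; rewrite -(ey _ fz) in gz.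
  exact: IHg gy gz.
- move=> v y z [fy lty] [fz ltz].
  case: (ltngtP y z) => // [/ltz|/lty] [t ft].
    by have := IHf _ _ _ ft fy.
  by have := IHf _ _ _ ft fz.
Qed.

(* Inputs are numbered by [pickle].  On a finite type any numbering is
   effective; on pairs, sequences and numbers it is an explicit arithmetical
   coding. *)
Definition decidable_problem (T : countType) (P : T -> Prop) : Prop :=
  exists p : recf 1, forall t : T,
    (P t -> reval p [tuple pickle t] 1%N) /\
    (~ P t -> reval p [tuple pickle t] 0%N).

(* Main.v *)
(* Positive instances are semidecidable by enumerating words, so by Post's
   theorem it suffices to certify negative ones. If [x2] is a nontrivial reduced
   word and [x1 = u^-1 x2 u], then, up to inverting both [x1] and [x2], there are
   words with [u = w (p q)^k p v^-1], [x2 = w p q w^-1] and [x1 = v q p v^-1]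
   literally, without cancellation (lemma [conjugate_conj_form]). Whether
   automata saturated under free reduction accept such words depends only on the
   state relations induced by [w], [v], [p], [q] and their inverses, and on the
   reflexive-transitive closure of that of [p q]. There are finitely many such
   relations, so a finite list of them, together with the saturation, certifies
   that there is no solution. *)
Require Import Defs.
From mathcomp Require Import all_boot.
From mathcomp Require boolp.

Set Implicit Arguments.
Unset Strict Implicit.
Unset Printing Implicit Defensive.

(** * Recursive functions and computable maps between countable types *)

(** The relations in a certificate need not be exact. Soundness uses only that they contain the true
    ones: the conditions are finitely many inclusions, hence checkable, and induction along words
    turns them into upper bounds for all words at once. Completeness takes the true relations
    themselves, which exist by classical comprehension over a finite state list and never have to be
    computed. Literal factorisations matter for soundness alone, where a path spelling a reduced
    word is cut at the factor boundaries. Conversely, arbitrary group elements [w], [v], [p], [q]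
    and any exponent [k] give conjugate elements by a group identity, so a certificate does not
    record which products are reduced. *)

Definition recursive n (F : n.-tuple nat -> nat) : Prop :=
  exists p : recf n, forall v, reval p v (F v).

Lemma recursive_ext n (F G : n.-tuple nat -> nat) :
  F =1 G -> recursive F -> recursive G.
Proof. by move=> FG [p pF]; exists p => v; rewrite -FG. Qed.

Lemma recursive_proj n (i : 'I_n) : recursive (fun v => tnth v i).
Proof. by exists (RProj i). Qed.

Lemma recursive_comp m n (F : m.-tuple nat -> nat)
    (G : 'I_m -> n.-tuple nat -> nat) :
  recursive F -> (forall i, recursive (G i)) ->
  recursive (fun v => F [tuple G i v | i < m]).
Proof.
move=> [p pF] /fin_all_exists[q qG]; exists (RComp p q) => v /=.
by exists [tuple G i v | i < m] => // i; rewrite tnth_mktuple.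
Qed.

Lemma recursive_comp1 n (F : nat -> nat) (G : n.-tuple nat -> nat) :
  recursive (fun v : 1.-tuple nat => F (thead v)) -> recursive G ->
  recursive (fun v => F (G v)).
Proof.
move=> rF rG; have := recursive_comp rF (fun=> rG).
by apply: recursive_ext => v; rewrite /thead tnth_mktuple.
Qed.

Lemma recursive_S n (G : n.-tuple nat -> nat) :
  recursive G -> recursive (fun v => (G v).+1).
Proof. by apply: recursive_comp1; exists RSucc. Qed.

Lemma recursive_const n c : recursive (fun _ : n.-tuple nat => c).
Proof.
by elim: c => [|c IHc]; [exists (RZero n) | apply: recursive_S].
Qed.

Fixpoint nat_primrec (b : nat) (step : nat -> nat -> nat) k :=
  if k is j.+1 then step j (nat_primrec b step j) else b.

Lemma recursive_primrec n (B K : n.-tuple nat -> nat)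
    (step : n.-tuple nat -> nat -> nat -> nat) :
  recursive B -> recursive K ->
  recursive (fun v : n.+2.-tuple nat =>
    step [tuple of behead (behead v)] (thead v) (thead [tuple of behead v])) ->
  recursive (fun v => nat_primrec (B v) (step v) (K v)).
Proof.
move=> [pB hB] rK [pS hS].
have rR : recursive (fun v : n.+1.-tuple nat =>
    nat_primrec (B [tuple of behead v]) (step [tuple of behead v]) (thead v)).
  exists (RRec pB pS) => v /=; set w := [tuple of behead v].
  elim: (thead v) => [|j IHj] //=; exists (nat_primrec (B w) (step w) j) => //.
  have := hS [tuple of j :: nat_primrec (B w) (step w) j :: w].
  rewrite /thead /= !(tnth_nth 0) /=.
  by congr (reval _ _ (step _ _ _)); apply/val_inj.
(* [RRec] recurses on its first argument, so [K v] is substituted there and the parameters follow as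
   projections. *)
have rG (i : 'I_n.+1) :
    recursive (fun v => if unlift ord0 i is Some j then tnth v j else K v).
  by case: (unlift ord0 i) => [j|//]; apply: recursive_proj.
apply: recursive_ext (recursive_comp rR rG) => v.
rewrite /thead tnth_mktuple unlift_none; set w := [tuple of behead _].
suff -> : w = v by [].
apply: eq_from_tnth => i; rewrite tnth_behead tnth_mktuple.
suff -> : inord i.+1 = lift ord0 i by rewrite liftK.
by apply: val_inj; rewrite /= inordK // ltnS.
Qed.

Lemma recursive_drop2 n (F : n.-tuple nat -> nat) :
  recursive F ->
  recursive (fun v : n.+2.-tuple nat => F [tuple of behead (behead v)]).
Proof.
move=> rF; have := recursive_comp rF
  (fun i => recursive_proj (lift (@ord0 n.+1) (lift (@ord0 n) i))).
apply: recursive_ext => v; congr F; apply: eq_from_tnth => i.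
rewrite tnth_mktuple !tnth_behead; congr (tnth _ _); apply: val_inj => /=.
by rewrite !inordK ?ltnS.
Qed.

Lemma recursive_thead n : recursive (fun v : n.+1.-tuple nat => thead v).
Proof. exact: recursive_proj. Qed.

Lemma recursive_thead_behead n : 
  recursive (fun v : n.+2.-tuple nat => thead [tuple of behead v]).
Proof.
apply: recursive_ext (recursive_proj (lift ord0 ord0)) => v.
by rewrite /thead tnth_behead; congr (tnth _ _); apply: val_inj; rewrite /= inordK.
Qed.

Lemma recursive_if n (K F G : n.-tuple nat -> nat) :
  recursive K -> recursive F -> recursive G ->
  recursive (fun v => if K v == 0 then F v else G v).
Proof.
move=> rK rF rG; have := recursive_primrec (step := fun v _ _ => G v) rF rK.
by move/(_ (recursive_drop2 rG)); apply: recursive_ext => v; case: (K v).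
Qed.

Lemma recursive_pred n (F : n.-tuple nat -> nat) :
  recursive F -> recursive (fun v => (F v).-1).
Proof.
move=> rF; have rS : recursive (fun v : n.+2.-tuple nat => thead v).
  exact: recursive_proj.
have := recursive_primrec (step := fun _ j _ => j) (recursive_const n 0) rF rS.
by apply: recursive_ext => v; case: (F v).
Qed.

Lemma recursive_add n (F G : n.-tuple nat -> nat) :
  recursive F -> recursive G -> recursive (fun v => F v + G v).
Proof.
move=> rF rG; have rS := recursive_S (recursive_thead_behead n).
have := recursive_primrec (step := fun _ _ z => z.+1) rG rF rS.
by apply: recursive_ext => v; elim: (F v) => //= k ->.
Qed.

Lemma recursive_sub n (F G : n.-tuple nat -> nat) :
  recursive F -> recursive G -> recursive (fun v => F v - G v).
Proof.
move=> rF rG; have rS := recursive_pred (recursive_thead_behead n).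
have := recursive_primrec (step := fun _ _ z => z.-1) rF rG rS.
by apply: recursive_ext => v; elim: (G v) => //= [|k ->]; rewrite ?subn0 // subnS.
Qed.

Lemma recursive_double n (F : n.-tuple nat -> nat) :
  recursive F -> recursive (fun v => (F v).*2).
Proof.
by move=> rF; apply: recursive_ext (recursive_add rF rF) => v; rewrite addnn.
Qed.

(** The recursion (k+1)/2 = k - k/2, with halves rounded down, needs no case distinction on
    parity. *)
Lemma recursive_half n (F : n.-tuple nat -> nat) :
  recursive F -> recursive (fun v => (F v)./2).
Proof.
move=> rF; have rS : recursive (fun v : n.+2.-tuple nat =>
    thead v - thead [tuple of behead v]).
  by apply: recursive_sub (recursive_thead_behead n); apply: recursive_proj.
have := recursive_primrec (step := fun _ j z => j - z) (recursive_const n 0) rF rS.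
apply: recursive_ext => v; elim: (F v) => //= k ->.
by rewrite uphalf_half -{1}(odd_double_half k) -addnn addnA addnK.
Qed.

(* [CodeSeq.code (n :: s)] is [code_cons n (CodeSeq.code s)]. *)
Definition code_cons n c := 2 ^ n * c.*2.+1.
(** Primitive recursion cannot stop early, so halving runs for [k] rounds and leaves odd numbers
    unchanged; [z - z./2.*2] is the parity of [z]. The decoders use [m] rounds, enough because the
    exponent of 2 in [m > 0] is below [m]. *)
Definition strip_twos m k :=
  nat_primrec m (fun _ z => if z - z./2.*2 == 0 then z./2 else z) k.
Definition code_head m :=
  nat_primrec 0
    (fun j z => if strip_twos m j - (strip_twos m j)./2.*2 == 0 then z.+1 else z)
    m.
Definition code_tail m := (strip_twos m m)./2.

Lemma sub_half_double z : z - z./2.*2 = odd z.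
Proof. by rewrite -{1}(odd_double_half z) addnK. Qed.

Lemma strip_twos_cons n c k :
  strip_twos (code_cons n c) k = 2 ^ (n - k) * c.*2.+1.
Proof.
elim: k => [|k IHk]; rewrite /strip_twos /=; first by rewrite subn0.
rewrite -/(strip_twos _ _) IHk sub_half_double subnS.
case: (n - k) => [|j]; first by rewrite expn0 !mul1n oddS odd_double.
by rewrite expnS -mulnA mul2n odd_double /= doubleK.
Qed.

Lemma ltn_code_cons n c : n < code_cons n c.
Proof. by apply: leq_trans (ltn_expl n (ltnSn 1)) _; rewrite leq_pmulr. Qed.

Lemma code_head_cons n c : code_head (code_cons n c) = n.
Proof.
rewrite /code_head; set step := (fun j z => _).
suff count k : nat_primrec 0 step k = minn k n.
  by rewrite count; apply/minn_idPr/ltnW/ltn_code_cons.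
elim: k => [|k IHk] /=; first by rewrite min0n.
rewrite IHk /step strip_twos_cons sub_half_double.
case: (ltnP k n) => [lt_kn|le_nk].
  rewrite -(subnSK lt_kn) expnS -mulnA mul2n odd_double.
  by rewrite (minn_idPl lt_kn).
rewrite (eqP le_nk) expn0 mul1n oddS odd_double.
by rewrite (minn_idPr (leqW le_nk)).
Qed.

Lemma code_tail_cons n c : code_tail (code_cons n c) = c.
Proof.
rewrite /code_tail strip_twos_cons (eqP (ltnW (ltn_code_cons n c))) mul1n.
by rewrite /= uphalf_double.
Qed.

Lemma recursive_code_cons n (F G : n.-tuple nat -> nat) :
  recursive F -> recursive G -> recursive (fun v => code_cons (F v) (G v)).
Proof.
move=> rF rG; have rB := recursive_S (recursive_double rG).
have rS := recursive_double (recursive_thead_behead n).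
have := recursive_primrec (step := fun _ _ z => z.*2) rB rF rS.
apply: recursive_ext => v; rewrite /code_cons.
by elim: (F v) => [|k IHk] /=; rewrite ?mul1n // IHk expnS -mulnA mul2n.
Qed.

Lemma recursive_strip_twos n (F K : n.-tuple nat -> nat) :
  recursive F -> recursive K -> recursive (fun v => strip_twos (F v) (K v)).
Proof.
move=> rF rK; apply: (recursive_primrec
  (step := fun _ _ z => if z - z./2.*2 == 0 then z./2 else z) rF rK).
have rz := recursive_thead_behead n; have rh := recursive_half rz.
by apply: (recursive_if _ rh rz); apply: (recursive_sub rz) (recursive_double rh).
Qed.

Lemma recursive_code_tail n (F : n.-tuple nat -> nat) :
  recursive F -> recursive (fun v => code_tail (F v)).
Proof. by move=> rF; apply: recursive_half (recursive_strip_twos rF rF). Qed.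

Lemma recursive_code_head n (F : n.-tuple nat -> nat) :
  recursive F -> recursive (fun v => code_head (F v)).
Proof.
move=> rF; apply: (recursive_primrec
  (step := fun v j z => if strip_twos (F v) j - (strip_twos (F v) j)./2.*2 == 0
                        then z.+1 else z) (recursive_const n 0) rF).
have rz := recursive_thead_behead n.
have rs := recursive_strip_twos (recursive_drop2 rF) (recursive_thead n.+1).
apply: recursive_if (recursive_S rz) rz.
by apply: recursive_sub rs (recursive_double (recursive_half rs)).
Qed.

Lemma recursive_eq_if n (F G H K : n.-tuple nat -> nat) :
  recursive F -> recursive G -> recursive H -> recursive K ->
  recursive (fun v => if F v == G v then H v else K v).
Proof.
move=> rF rG rH rK.
have rD := recursive_add (recursive_sub rF rG) (recursive_sub rG rF).
have := recursive_if rD rH rK.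
by apply: recursive_ext => v; rewrite addn_eq0 !subn_eq0 -eqn_leq.
Qed.

(** * Maps between countable types, computed on codes *)

Definition computable (T U : countType) (f : T -> U) : Prop :=
  exists2 F : nat -> nat, recursive (fun v : 1.-tuple nat => F (thead v))
    & forall t, F (pickle t) = pickle (f t).

Lemma computable_id (T : countType) : computable (fun t : T => t).
Proof. by exists id => //; apply: recursive_thead. Qed.

Lemma computable_comp (T U V : countType) (f : U -> V) (g : T -> U) :
  computable f -> computable g -> computable (fun t => f (g t)).
Proof.
move=> [F rF hF] [G rG hG]; exists (fun n => F (G n)).
  exact: recursive_comp1.
by move=> t; rewrite hG hF.
Qed.

Lemma computable_const (T U : countType) (c : U) : computable (fun _ : T => c).
Proof. by exists (fun=> pickle c) => //; apply: recursive_const. Qed.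

Lemma computable_ext (T U : countType) (f g : T -> U) :
  f =1 g -> computable f -> computable g.
Proof. by move=> fg [F rF hF]; exists F => // t; rewrite hF fg. Qed.

(** A natural number is its own code, so the same [F] works. *)
Lemma computable_pickle (T U : countType) (f : T -> U) :
  computable f -> computable (fun t => pickle (f t)).
Proof. by []. Qed.

Lemma pickle_pairE (T U : countType) (x : T) (y : U) :
  pickle (x, y) = code_cons (pickle x) (code_cons (pickle y) 0).
Proof. by []. Qed.

Lemma pickle_consE (T : countType) (x : T) s :
  pickle (x :: s) = code_cons (pickle x) (pickle s).
Proof. by []. Qed.

Section Closure.

Variable T : countType.

Lemma computable_pair (U V : countType) (f : T -> U) (g : T -> V) :
  computable f -> computable g -> computable (fun t => (f t, g t)).
Proof.
move=> [F rF hF] [G rG hG].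
exists (fun n => code_cons (F n) (code_cons (G n) 0)).
  do 2!apply: recursive_code_cons => //; exact: recursive_const.
by move=> t; rewrite hF hG.
Qed.

Lemma computable_fst (U V : countType) (f : T -> U * V) :
  computable f -> computable (fun t => (f t).1).
Proof.
move=> [F rF hF]; exists (fun n => code_head (F n)).
  exact: recursive_code_head.
by move=> t; rewrite hF; case: (f t) => x y; rewrite pickle_pairE code_head_cons.
Qed.

Lemma computable_snd (U V : countType) (f : T -> U * V) :
  computable f -> computable (fun t => (f t).2).
Proof.
move=> [F rF hF]; exists (fun n => code_head (code_tail (F n))).
  exact/recursive_code_head/recursive_code_tail.
move=> t; rewrite hF; case: (f t) => x y.
by rewrite pickle_pairE code_tail_cons code_head_cons.
Qed.

Lemma computable_cons (U : countType) (f : T -> U) (g : T -> seq U) :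
  computable f -> computable g -> computable (fun t => f t :: g t).
Proof.
move=> [F rF hF] [G rG hG]; exists (fun n => code_cons (F n) (G n)).
  exact: recursive_code_cons.
by move=> t; rewrite hF hG.
Qed.

Lemma computable_behead (U : countType) (f : T -> seq U) :
  computable f -> computable (fun t => behead (f t)).
Proof.
move=> [F rF hF]; exists (fun n => code_tail (F n)).
  exact: recursive_code_tail.
move=> t; rewrite hF; case: (f t) => // x s.
by rewrite pickle_consE code_tail_cons.
Qed.

Lemma pickle_seq_eq0 (U : countType) (s : seq U) :
  (pickle s == 0) = (s == [::]).
Proof.
case: s => // x s; rewrite pickle_consE -leqn0 leqNgt.
by rewrite (leq_ltn_trans _ (ltn_code_cons _ _)).
Qed.

Lemma computable_head (U : countType) (f : T -> U) (g : T -> seq U) :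
  computable f -> computable g -> computable (fun t => head (f t) (g t)).
Proof.
move=> [F rF hF] [G rG hG].
exists (fun n => if G n == 0 then F n else code_head (G n)).
  by apply: recursive_if (recursive_code_head _).
move=> t; rewrite hF hG pickle_seq_eq0; case: (g t) => // x s.
by rewrite pickle_consE code_head_cons.
Qed.

Lemma computable_eq (U : countType) (f g : T -> U) :
  computable f -> computable g -> computable (fun t => f t == g t).
Proof.
move=> [F rF hF] [G rG hG].
exists (fun n => if F n == G n then pickle true else pickle false).
  by apply: recursive_eq_if => //; apply: recursive_const.
by move=> t; rewrite hF hG (inj_eq (pcan_inj pickleK)); case: eqP.
Qed.

Lemma computable_if (U : countType) (b : T -> bool) (f g : T -> U) :
  computable b -> computable f -> computable g ->
  computable (fun t => if b t then f t else g t).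
Proof.
move=> [B rB hB] [F rF hF] [G rG hG].
exists (fun n => if B n == 0 then G n else F n); first exact: recursive_if.
by move=> t; rewrite hB; case: (b t) => /=.
Qed.

Lemma computable_iter (U : countType) (n : T -> nat) (f : T -> U -> U)
    (x : T -> U) :
  computable n -> computable (fun c => f c.1 c.2) -> computable x ->
  computable (fun t => iter (n t) (f t) (x t)).
Proof.
move=> [N rN hN] [F rF hF] [X rX hX].
exists (fun m =>
  nat_primrec (X m) (fun _ z => F (code_cons m (code_cons z 0))) (N m)).
  apply: (recursive_primrec
    (step := fun v _ z => F (code_cons (thead v) (code_cons z 0)))) => //.
  apply: recursive_comp1 rF _; apply: recursive_code_cons.
    exact: (recursive_drop2 (recursive_thead 0)).
  by apply: recursive_code_cons (recursive_const _ _); apply: recursive_thead_behead.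
move=> t; rewrite hN hX /=; elim: (n t) => //= k ->.
by rewrite -(pickle_pairE t) hF.
Qed.

End Closure.

(** A fold is an iteration on pairs of remaining list and accumulator. The number of rounds is the
    code of the list, which is at least its length; extra rounds on the empty list change
    nothing. *)
Lemma computable_foldl (T U V : countType) (f : T -> U -> V -> U) (z : T -> U)
    (s : T -> seq V) :
  computable (fun c => f c.1.1 c.1.2 c.2) -> computable z -> computable s ->
  computable (fun t => foldl (f t) (z t) (s t)).
Proof.
(* [head] needs a default element of [V]; if [V] is empty, every list over it is empty and the fold
   returns [z]. *)
move=> cf cz cs; case: (boolp.pselect (exists _ : V, True)) => [[x0 _]|noV].
  pose step t (c : seq V * U) :=
    if c.1 == [::] then c else (behead c.1, f t c.2 (head x0 c.1)).
  have cid c := @computable_id c.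
  have c2 (W : countType) := computable_snd (cid (T * W)%type).
  have c21 := computable_fst (c2 (seq V * U)%type).
  have c22 := computable_snd (c2 (seq V * U)%type).
  have cstep : computable (fun c => step c.1 c.2).
    rewrite /step.
    apply: (computable_if _ (c2 _)); first exact/computable_eq/computable_const.
    apply: computable_pair.
      exact: computable_behead.
    apply: (computable_comp (f := fun c => f c.1.1 c.1.2 c.2) cf
      (g := fun c => (c.1, c.2.2, head x0 c.2.1))).
    apply: computable_pair.
      by apply: computable_pair c22; apply: computable_fst.
    exact: computable_head (computable_const _ _) _.
  have := computable_snd (computable_iter (computable_pickle cs) cstep
    (computable_pair cs cz)).
  apply: computable_ext => t /=.
  have iter_step k r u : size r <= k ->
      (iter k (step t) (r, u)).2 =
      foldl (f t) u r.
    elim: k r u => [|k IHk] [|x r] u // le_rk; rewrite iterSr /step /= IHk //.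
  apply: iter_step; elim: (s t) => // x r IHr; rewrite pickle_consE.
  apply: leq_ltn_trans IHr _; rewrite /code_cons.
  apply: leq_trans (leq_pmull _ _); last by rewrite expn_gt0.
  by rewrite ltnS -addnn leq_addr.
apply: computable_ext cz => t; case: (s t) => // x.
by case: noV; exists x.
Qed.

Lemma computable_rev (T U : countType) (s : T -> seq U) :
  computable s -> computable (fun t => rev (s t)).
Proof.
move=> cs; have cid := @computable_id (T * seq U * U)%type.
have := computable_foldl (f := fun _ a x => x :: a)
  (computable_cons (computable_snd cid) (computable_snd (computable_fst cid)))
  (@computable_const T (seq U) [::]) cs.
apply: computable_ext => t /=; rewrite -[RHS]cats0 -catrevE.
by elim: (s t) [::] => //= x s' IHs a; rewrite IHs.
Qed.

Lemma computable_foldr (T U V : countType) (f : T -> V -> U -> U)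
    (z : T -> U) (s : T -> seq V) :
  computable (fun c => f c.1.1 c.1.2 c.2) -> computable z -> computable s ->
  computable (fun t => foldr (f t) (z t) (s t)).
Proof.
move=> cf cz /computable_rev cs; have cid := @computable_id (T * U * V)%type.
have cg : computable (fun c : T * U * V => f c.1.1 c.2 c.1.2).
  apply: (computable_comp cf (g := fun c => (c.1.1, c.2, c.1.2))).
  have c1 := computable_fst cid.
  apply: computable_pair (computable_snd c1).
  exact: computable_pair (computable_fst c1) (computable_snd cid).
have := computable_foldl (f := fun t u x => f t x u) cg cz cs.
by apply: computable_ext => t /=; rewrite foldl_rev.
Qed.

Lemma computable_cat (T U : countType) (s1 s2 : T -> seq U) :
  computable s1 -> computable s2 -> computable (fun t => s1 t ++ s2 t).
Proof.
move=> c1 c2; have cid := @computable_id (T * U * seq U)%type.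
have := computable_foldr (f := fun _ x a => x :: a)
  (computable_cons (computable_snd (computable_fst cid)) (computable_snd cid))
  c2 c1.
by apply: computable_ext => t /=; elim: (s1 t) => //= x s ->.
Qed.

Lemma computable_flatten_map (T U V : countType) (f : T -> U -> seq V)
    (s : T -> seq U) :
  computable (fun c => f c.1 c.2) -> computable s ->
  computable (fun t => flatten [seq f t x | x <- s t]).
Proof.
move=> cf cs; have cid := @computable_id (T * U * seq V)%type.
have := computable_foldr (f := fun t x a => f t x ++ a)
  (computable_cat (computable_comp cf (computable_fst cid)) (computable_snd cid))
  (@computable_const T (seq V) [::]) cs.
by apply: computable_ext => t /=; elim: (s t) => //= x s' ->.
Qed.

Lemma computable_map (T U V : countType) (f : T -> U -> V) (s : T -> seq U) :
  computable (fun c => f c.1 c.2) -> computable s ->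
  computable (fun t => [seq f t x | x <- s t]).
Proof.
move=> cf cs; have := computable_flatten_map (f := fun t x => [:: f t x])
  (computable_cons cf (computable_const _ [::])) cs.
by apply: computable_ext => t; elim: (s t) => //= x s' ->.
Qed.

Lemma computable_filter (T U : countType) (p : T -> U -> bool) (s : T -> seq U) :
  computable (fun c => p c.1 c.2) -> computable s ->
  computable (fun t => [seq x <- s t | p t x]).
Proof.
move=> cp cs; have csing : computable (fun c : T * U => [:: c.2]).
  by apply/computable_cons/computable_const/computable_snd/computable_id.
have := computable_flatten_map
  (f := fun t x => if p t x then [:: x] else [::])
  (computable_if cp csing (computable_const _ [::])) cs.
apply: computable_ext => t; elim: (s t) => //= x s' ->; by case: ifP.
Qed.

Lemma computable_has (T U : countType) (p : T -> U -> bool) (s : T -> seq U) :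
  computable (fun c => p c.1 c.2) -> computable s ->
  computable (fun t => has (fun x => p t x) (s t)).
Proof.
move=> cp cs; have := computable_eq (computable_filter cp cs) (computable_const _ [::]).
move/computable_if => /(_ _ _ _ (computable_const _ false) (computable_const _ true)).
by apply: computable_ext => t; rewrite has_filter; case: eqP.
Qed.

Lemma computable_negb (T : countType) (b : T -> bool) :
  computable b -> computable (fun t => ~~ b t).
Proof.
move=> /computable_if/(_ (computable_const _ false) (computable_const _ true)).
by apply: computable_ext => t; case: (b t).
Qed.

Lemma computable_and (T : countType) (b c : T -> bool) :
  computable b -> computable c -> computable (fun t => b t && c t).
Proof. by move=> cb cc; apply: computable_if => //; apply: computable_const. Qed.

Lemma computable_or (T : countType) (b c : T -> bool) :
  computable b -> computable c -> computable (fun t => b t || c t).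
Proof. by move=> cb cc; apply: computable_if => //; apply: computable_const. Qed.

Lemma computable_impl (T : countType) (b c : T -> bool) :
  computable b -> computable c -> computable (fun t => b t ==> c t).
Proof. by move=> cb cc; apply: computable_if => //; apply: computable_const. Qed.

Lemma computable_all (T U : countType) (p : T -> U -> bool) (s : T -> seq U) :
  computable (fun c => p c.1 c.2) -> computable s ->
  computable (fun t => all (fun x => p t x) (s t)).
Proof.
move=> cp cs; have := computable_negb
  (computable_has (p := fun t x => ~~ p t x) (computable_negb cp) cs).
apply: computable_ext => t; rewrite -all_predC; apply: eq_all => x /=.
exact: negbK.
Qed.

Lemma computable_mem (T U : countType) (f : T -> U) (s : T -> seq U) :
  computable f -> computable s -> computable (fun t => f t \in s t).
Proof.
move=> cf cs; have := computable_has (p := fun t x => x == f t)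
  (computable_eq (computable_snd (computable_id _))
     (computable_comp cf (computable_fst (computable_id _)))) cs.
by apply: computable_ext => t; rewrite -has_pred1.
Qed.

(** A finite table, extended by one entry at a time along the enumeration. *)
Lemma computable_finType (T : finType) (U : countType) (f : T -> U) :
  computable f.
Proof.
suff [F rF hF] : exists2 F : nat -> nat,
    recursive (fun v : 1.-tuple nat => F (thead v))
    & {in enum T, forall t, F (pickle t) = pickle (f t)}.
  by exists F => // t; apply: hF; rewrite mem_enum.
elim: (enum T) => [|a s [F rF hF]].
  by exists id; first exact: recursive_thead.
exists (fun n => if n == pickle a then pickle (f a) else F n).
  apply: recursive_eq_if; rewrite //; first exact: recursive_thead.
    exact: recursive_const.
  exact: recursive_const.
move=> t; rewrite inE (inj_eq (pcan_inj pickleK)).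
by case: eqP => [->|_ /hF].
Qed.

(* A number that is not the code of an element may be decoded to anything:
   total decoders are what an unbounded search over all numbers needs. *)
Definition decodable (T : countType) : Prop :=
  exists2 d : nat -> seq T, computable d & forall x, d (pickle x) = [:: x].

Lemma decodable_nat : decodable nat.
Proof.
exists (fun n => [:: n]) => //.
exact: computable_cons (computable_id _) (computable_const _ _).
Qed.

Lemma decodable_finType (T : finType) : decodable T.
Proof.
exists (fun n => [seq x <- enum T | pickle x == n]).
  apply: (computable_filter (p := fun n x => pickle x == n)).
    apply: computable_eq (computable_fst (computable_id _)).
    exact/computable_pickle/computable_snd/computable_id.
  exact: computable_const.
move=> x; rewrite -[RHS](filter_pred1_uniq (enum_uniq T)) ?mem_enum //.
by apply: eq_filter => y; rewrite /= (inj_eq (pcan_inj pickleK)).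
Qed.

Lemma computable_code_head (T : countType) (f : T -> nat) :
  computable f -> computable (fun t => code_head (f t)).
Proof.
move=> [F rF hF]; exists (fun n => code_head (F n)) => [|t]; last by rewrite hF.
exact: recursive_code_head.
Qed.

Lemma computable_code_tail (T : countType) (f : T -> nat) :
  computable f -> computable (fun t => code_tail (f t)).
Proof.
move=> [F rF hF]; exists (fun n => code_tail (F n)) => [|t]; last by rewrite hF.
exact: recursive_code_tail.
Qed.

Lemma decodable_prod (T U : countType) :
  decodable T -> decodable U -> decodable (T * U)%type.
Proof.
move=> [d cd hd] [e ce he].
exists (fun n => flatten [seq [seq (x, y) | y <- e (code_head (code_tail n))]
                         | x <- d (code_head n)]).
  apply: (computable_flatten_map
    (f := fun n x => [seq (x, y) | y <- e (code_head (code_tail n))])).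
    apply: (computable_map (f := fun c y => (c.2, y))).
      apply: computable_pair; last exact/computable_snd/computable_id.
      exact/computable_snd/computable_fst/computable_id.
    apply: computable_comp ce _.
    exact/computable_code_head/computable_code_tail/computable_fst/computable_id.
  exact/(computable_comp cd)/computable_code_head/computable_id.
case=> x y; rewrite pickle_pairE code_tail_cons !code_head_cons.
by rewrite hd he.
Qed.

Lemma decodable_seq (T : countType) : decodable T -> decodable (seq T).
Proof.
move=> [d cd hd].
exists (fun n => [:: flatten [seq d m | m <- CodeSeq.decode n]]).
  apply/computable_cons/computable_const.
  apply: (computable_flatten_map (f := fun _ m => d m)).
    exact/(computable_comp cd)/computable_snd/computable_id.
  (* Lists of numbers are in bijection with numbers, and [CodeSeq.decode n] has code [n]; so the
     identity computes it. *)
  exists id => [|n]; first exact: recursive_thead.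
  by rewrite -[LHS]CodeSeq.decodeK; congr CodeSeq.code; rewrite map_id.
move=> s; rewrite CodeSeq.codeK -map_comp; congr [:: _].
by elim: s => //= x s ->; rewrite hd.
Qed.

(* Post's theorem, by unbounded search. *)
Lemma decidable_by_certificates (T C D : countType) (P : T -> Prop)
    (yes : T * C -> bool) (no : T * D -> bool) :
  decodable C -> decodable D -> computable yes -> computable no ->
  (forall t, P t <-> exists c, yes (t, c)) ->
  (forall t, ~ P t <-> exists c, no (t, c)) ->
  decidable_problem P.
Proof.
move=> [dC cdC hC] [dD cdD hD] cyes cno Pyes Pno.
pose Y (c : T * nat) := has (fun x => yes (c.1, x)) (dC c.2).
pose N (c : T * nat) := has (fun x => no (c.1, x)) (dD c.2).
have c1 := computable_fst (computable_id (T * nat)%type).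
have c2 := computable_snd (computable_id (T * nat)%type).
have cin (W : countType) : computable (fun c : T * nat * W => (c.1.1, c.2)).
  apply: computable_pair; last exact/computable_snd/computable_id.
  exact/computable_fst/computable_fst/computable_id.
have [FY rY hY] : computable Y.
  by apply: (computable_has (p := fun c x => yes (c.1, x))); apply: computable_comp.
have [FN rN hN] : computable N.
  by apply: (computable_has (p := fun c x => no (c.1, x))); apply: computable_comp.
have YP t n : Y (t, n) -> P t by case/hasP=> x _ yx; apply/Pyes; exists x.
have NP t n : N (t, n) -> ~ P t by case/hasP=> x _ yx; apply/Pno; exists x.
have rpair : recursive (fun v : 2.-tuple nat =>
    code_cons (tnth v ord_max) (code_cons (tnth v ord0) 0)).
  do 2!(apply: recursive_code_cons; first exact: recursive_proj).
  exact: recursive_const.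
(* [RMin] stops at the first zero, so success is encoded by 0 and failure by 1. *)
have [q hq] : recursive (fun v : 2.-tuple nat =>
    if FY (code_cons (tnth v ord_max) (code_cons (tnth v ord0) 0)) == 0 then
      (if FN (code_cons (tnth v ord_max) (code_cons (tnth v ord0) 0)) == 0
       then 1 else 0)
    else 0).
  have r0 n := recursive_const 2 n.
  apply: recursive_if (r0 0); first exact: recursive_comp1 rY rpair.
  by apply: recursive_if => //; apply: recursive_comp1 rN rpair.
have {}hq t n : reval q [tuple n; pickle t] (~~ (Y (t, n) || N (t, n))).
  have := hq [tuple n; pickle t]; rewrite !(tnth_nth 0) /=.
  rewrite -[code_cons (pickle t) _]/(pickle (t, n)).
  by rewrite hY hN; case: (Y _); case: (N _).
have [p hp] : recursive (fun v : 2.-tuple nat =>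
    FY (code_cons (tnth v ord_max) (code_cons (tnth v ord0) 0))).
  exact: recursive_comp1 rY rpair.
have {}hp t n : reval p [tuple n; pickle t] (Y (t, n)).
  have := hp [tuple n; pickle t]; rewrite !(tnth_nth 0) /=.
  rewrite -[code_cons (pickle t) _]/(pickle (t, n)).
  by rewrite hY; case: (Y _).
(* The number found is passed to [p], which reports whether it certifies a positive instance. *)
pose g (i : 'I_2) := if i == ord0 then RMin q else RProj ord0.
exists (RComp p g) => t.
(* The search halts because, by excluded middle, one of the two kinds of certificate exists. *)
have /ex_minnP[m hm min_m] : exists n, Y (t, n) || N (t, n).
  case: (boolp.pselect (P t)) => [/Pyes|/Pno] [c hc]; exists (pickle c).
    by apply/orP; left; rewrite /Y hC /= hc.
  by apply/orP; right; rewrite /N hD /= hc.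
have run : reval (RComp p g) [tuple pickle t] (Y (t, m)).
  exists [tuple m; pickle t] => // i; rewrite /g.
  case: (unliftP ord0 i) => [j ->|->] /=; last first.
    rewrite (tnth_nth 0) /=; split.
      by have := hq t m; rewrite hm.
    move=> z lt_zm; exists 0; have := hq t z.
    have -> : (Y (t, z) || N (t, z)) = false.
      by apply/negP => /min_m; rewrite leqNgt lt_zm.
    by [].
  by rewrite !(tnth_nth 0) ord1.
split=> hP.
  by case/orP: hm run => [->|/NP].
by move: run; have -> : Y (t, m) = false by apply/negP => /YP.
Qed.

(** * Conjugation of reduced words *)

Section ReducedWords.

Local Open Scope group_scope.

Variable A : finType.
Implicit Types (a b : letter A) (u v w x y p q c : seq (letter A)).

Lemma linv_neq a : linv a != a.
Proof. by case: a => a []; rewrite /linv xpair_eqE andbF. Qed.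

Lemma linv_inj : injective (@linv A).
Proof. exact: can_inj (@linvK A). Qed.

Lemma winv_cat u v : winv (u ++ v) = winv v ++ winv u.
Proof. by rewrite /winv map_cat rev_cat. Qed.

Lemma winv_cons a u : winv (a :: u) = rcons (winv u) (linv a).
Proof. by rewrite /winv /= rev_cons. Qed.

Lemma reduced_winv w : reduced (winv w) = reduced w.
Proof.
rewrite /reduced /winv rev_sorted sorted_map; apply: eq_sorted => x y /=.
by rewrite linvK eq_sym.
Qed.

Lemma reduced_catl u v : reduced (u ++ v) -> reduced u.
Proof. by case/cat_sorted2. Qed.

Lemma reduced_cons2 a b w :
  reduced [:: a, b & w] = (b != linv a) && reduced (b :: w).
Proof. by []. Qed.

Lemma reduced_rcons b w a :
  reduced (rcons (b :: w) a) = reduced (b :: w) && (a != linv (last b w)).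
Proof. by rewrite /reduced /= rcons_path. Qed.

Lemma fgproj_inj u v : reduced u -> reduced v -> fgproj u = fgproj v -> u = v.
Proof. by move=> ru rv [] /=; rewrite !reduce_id. Qed.

Lemma fgproj_winv w : fgproj (winv w) = (fgproj w)^-1.
Proof.
apply: (mulgI (fgproj w)); rewrite -fgproj_cat mulgV.
by apply: val_inj; rewrite /= reduce_winvr.
Qed.

Lemma fgproj_linv a : fgproj [:: linv a] = (fgproj [:: a])^-1.
Proof. exact: (fgproj_winv [:: a]). Qed.

Definition word_pow k c := iter k (cat c) [::].

Lemma word_powSr k c : word_pow k.+1 c = word_pow k c ++ c.
Proof. by elim: k => [|k IHk] /=; rewrite ?cats0 // -catA -IHk. Qed.

Lemma word_pow_rot k p q : p ++ word_pow k (q ++ p) = word_pow k (p ++ q) ++ p.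
Proof. by elim: k => [|k IHk] /=; rewrite ?cats0 // -!catA IHk. Qed.

(* [w] and [v] conjugate the cyclically reduced cores [p ++ q] and [q ++ p] to
   [x2] and [x1], and the conjugator [u] turns [k] times around the core. *)
Definition conj_form u x1 x2 : Prop :=
  exists w v p q k,
    [/\ u = w ++ word_pow k (p ++ q) ++ p ++ winv v,
        x2 = w ++ (p ++ q) ++ winv w & x1 = v ++ (q ++ p) ++ winv v].

(** In [a x2 a^-1] the new letters may cancel at the front of [x2], at its end, at both or not at
    all. No cancellation lengthens [w]; cancellation at the end only rotates the core; at both ends
    it lengthens [v]; at the front only it forces a passage to inverses. *)
Lemma conj_form_cons a u x1 x2 y2 :
  reduced (a :: u) -> reduced x2 -> x2 != [::] -> reduced y2 ->
  fgproj y2 = fgproj [:: a] * fgproj x2 * (fgproj [:: a])^-1 ->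
  conj_form u x1 x2 ->
  conj_form (a :: u) x1 y2 \/ conj_form (a :: u) (winv x1) (winv y2).
Proof.
move=> rau rx2 nx2 ry2 ey2 [w [v [p [q [k [eu ex2 ex1]]]]]].
have red_y2 z : reduced z ->
    fgproj z = fgproj [:: a] * fgproj x2 * (fgproj [:: a])^-1 -> y2 = z.
  by move=> rz ez; apply: fgproj_inj; rewrite // ey2.
have {nx2} [d [s ec]] : exists d s, x2 = d :: s.
  by case: (x2) nx2 => // d s; exists d, s.
(* If [w] starts with [b], then so do [x2] and [u], and [x2] ends with [linv b]. Cancellation at
   either end would give [b = linv a], against [a :: u] being reduced. *)
have ew : head a x2 = linv a \/ last a x2 = a -> w = [::].
  case: (w) eu ex2 => // b w' eu ex2.
  have neq : b != linv a by move: rau; rewrite eu /= => /andP[].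
  rewrite ex2 winv_cons -cats1 !catA last_cat /=.
  case=> [eb|eb]; first by rewrite eb eqxx in neq.
  by rewrite -eb linvK eqxx in neq.
have [ea|na] := eqVneq d (linv a); last first.
  have [el|nl] := eqVneq (last d s) a; last first.
    have -> : y2 = a :: rcons x2 (linv a).
      apply: red_y2; last first.
        by rewrite -cats1 -cat1s !fgproj_cat fgproj_linv mulgA.
      rewrite ec -rcons_cons reduced_rcons reduced_cons2 na -ec rx2 ec /=.
      by rewrite (inj_eq linv_inj) eq_sym.
    left; exists (a :: w), v, p, q, k; split=> //; first by rewrite eu.
    by rewrite winv_cons ex2 !rcons_cat.
  have w0 : w = [::] by apply: ew; right; rewrite ec.
  subst w; rewrite /= cats0 in eu ex2 ex1 *; left.
  have ncat z : x2 = rcons z a -> y2 = a :: z.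
    move=> ez; apply: red_y2; last first.
      by rewrite ez -cats1 -[a :: z]cat1s !fgproj_cat mulgA mulgK.
    case: z ez => [|b z] ez //; rewrite reduced_cons2.
    have eb : b = d by move: ez; rewrite ec => -[].
    by rewrite {1}eb na; apply: (@reduced_catl _ [:: a]); rewrite cats1 -ez.
  (* The last letter [a] of the core moves to its front. It is taken from [q] if possible; otherwise
     from [p], and then the new [p] is the single letter [a] and one more full turn is completed. *)
  case/lastP: q => [|q0 b] in ex2 ex1 eu *.
    case/lastP: p => [|p0 b] in ex2 ex1 eu *; first by rewrite ex2 in ec.
    rewrite cats0 in ex2.
    have eb : b = a by rewrite -el -[last d s]/(last d (d :: s)) -ec ex2 last_rcons.
    subst b; exists [::], v, [:: a], p0, k.+1; split; first last.
    - by rewrite ex1 cats1.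
    - by rewrite cats0 /=; apply: ncat.
    rewrite eu cats0 -cats1 -cat1s catA (word_pow_rot k [:: a] p0).
    by rewrite word_powSr -!catA.
  have eb : b = a.
    rewrite -el -[last d s]/(last d (d :: s)) -ec ex2 -cats1 catA cats1.
    by rewrite last_rcons.
  subst b; exists [::], v, (a :: p), q0, k; split; first last.
  - by rewrite ex1 -cats1 -!catA.
  - by rewrite cats0 /=; apply: ncat; rewrite ex2 -!cats1 catA.
  rewrite eu -cats1 -cat1s catA [p ++ q0 ++ _]catA.
  by rewrite (word_pow_rot k [:: a] (p ++ q0)) -catA.
have w0 : w = [::] by apply: ew; left; rewrite ec.
subst w d; rewrite /= cats0 in eu ex2 ex1 ec *.
(* The core starts with [linv a], but [u] cannot. So [u] contains no part of the core: [p] is empty,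
   and below [k] is 0. *)
have p0 : p = [::].
  case: (p) eu ex2 => // b p' eu ex2.
  have eb : b = linv a by move: ec; rewrite ex2 => -[].
  by move: rau; rewrite eu eb; case: (k) => [|k'] /=; rewrite eqxx.
subst p; rewrite /= cats0 in eu ex2 ex1 *; subst q.
have k0 : k = 0%N.
  by case: k eu => // k' eu; move: rau; rewrite eu ec reduced_cons2 eqxx.
subst k; rewrite /= in eu; rewrite {}ec {ew} in rx2 ex1 ey2 red_y2 *.
case: (boolP (reduced (rcons s (linv a)))) => [red_s|].
  (* The only source of inverses: [y2] is [s] followed by [linv a], so its inverse starts with [a],
     which serves as [p]. *)
  right; exists [::], v, [:: a], (winv s), 0%N.
  rewrite /= cats0 cats1; split.
  - by rewrite eu.
  - have -> : y2 = rcons s (linv a).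
      apply: red_y2 => //; rewrite -cats1 -[_ :: s]cat1s !fgproj_cat fgproj_linv.
      by rewrite !mulgA mulgV mul1g.
    by rewrite /winv map_rcons rev_rcons linvK.
  - by rewrite ex1 !winv_cat winvK winv_cons linvK -cats1 -!catA.
case/lastP: s => [|s b] in rx2 ex1 ey2 red_y2 *; first by [].
case: s => [|d s] in rx2 ex1 ey2 red_y2 *.
  rewrite [rcons _ _]/= reduced_cons2 andbT negbK (inj_eq linv_inj) => /eqP eb.
  by move: rx2; rewrite eb /= linvK eqxx.
rewrite rcons_cons reduced_rcons.
have rs : reduced (d :: rcons s b) by case/andP: rx2.
rewrite rs /= last_rcons negbK (inj_eq linv_inj) => /eqP eb; subst b.
left; exists [::], (rcons v (linv a)), [::], (d :: s), 0%N.
rewrite /= cats0; split.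
- by rewrite eu -cats1 winv_cat /= linvK.
- apply: red_y2.
    by apply: (@reduced_catl _ [:: a]); rewrite cats1.
  rewrite -[linv a :: _]cat1s -cats1 !fgproj_cat fgproj_linv !mulgA mulgV mul1g.
  by rewrite mulgK.
- by rewrite ex1 -!cats1 winv_cat /= linvK -!catA.
Qed.



Lemma conjugate_conj_form u x1 x2 :
  reduced u -> reduced x1 -> reduced x2 -> x2 != [::] ->
  fgproj x1 = (fgproj u)^-1 * fgproj x2 * fgproj u ->
  conj_form u x1 x2 \/ conj_form u (winv x1) (winv x2).
Proof.
move=> ru rx1; elim: u => [|a u IHu] in ru x2 * => rx2 nx2 ex1.
  have {}ex1 : x1 = x2.
    by apply: fgproj_inj; rewrite // ex1 fgproj_nil invg1 mul1g mulg1.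
  by left; exists [::], [::], [::], x1, 0%N; rewrite /= -ex1 !cats0.
pose g : freegroup A := (fgproj [:: a])^-1 * fgproj x2 * fgproj [:: a].
have eg : fgproj x2 = fgproj [:: a] * fgproj g * (fgproj [:: a])^-1.
  by rewrite fgprojK /g !mulgA mulgK mulgV mul1g.
have ng : (g : seq _) != [::].
  apply: contraNneq nx2 => eg0; apply/eqP/fgproj_inj => //.
  by rewrite eg eg0 !fgproj_nil mulg1 mulgV.
have eg1 : fgproj x1 = (fgproj u)^-1 * fgproj g * fgproj u.
  by rewrite ex1 eg -[a :: u]cat1s fgproj_cat invgM !mulgA !mulgVK.
have nwinv x : x != [::] -> winv x != [::].
  by apply: contraNneq => ex; rewrite -[x]winvK ex.
case: (IHu (path_sorted ru) g (fgwordP g) ng eg1) => cu.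
  exact: conj_form_cons ru (fgwordP g) ng rx2 eg cu.
(* The step is applied to the inverse words, which exchanges the two alternatives. *)
have := conj_form_cons (y2 := winv x2) ru _ (nwinv _ ng) _ _ cu.
rewrite !winvK !reduced_winv => /(_ (fgwordP g) rx2) redg.
apply/or_comm/redg.
by rewrite !fgproj_winv eg !invgM invgK !mulgA.
Qed.

End ReducedWords.

(** * Certificates of unsolvability *)

Section Relations.

Variable Q : countType.
Implicit Types (r : seq (Q * Q)) (I F : seq Q).

Definition comp_rel r1 r2 :=
  flatten [seq [seq (a.1, b.2) | b <- [seq b <- r2 | a.2 == b.1]] | a <- r1].

Lemma comp_relP r1 r2 p q :
  reflect (exists2 s, (p, s) \in r1 & (s, q) \in r2)
    ((p, q) \in comp_rel r1 r2).
Proof.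
apply: (iffP flattenP) => [[_ /mapP[[p' s] r1ps ->]]|[s r1ps r2sq]].
  case/mapP=> [[s1 q1]]; rewrite mem_filter /= => /andP[/eqP<- r2sq] [-> ->].
  by exists s.
exists [seq (p, b.2) | b <- [seq b <- r2 | s == b.1]].
  by apply/mapP; exists (p, s).
by apply/mapP; exists (s, q); rewrite // mem_filter eqxx.
Qed.

Definition sub_rel r1 r2 := all (fun e => e \in r2) r1.

Lemma sub_relP r1 r2 : reflect {subset r1 <= r2} (sub_rel r1 r2).
Proof. exact: allP. Qed.

Definition links I r F := has (fun e => (e.1 \in I) && (e.2 \in F)) r.

Lemma linksP I r F :
  reflect (exists p q, [/\ p \in I, q \in F & (p, q) \in r]) (links I r F).
Proof.
apply: (iffP hasP) => [[[p q] rpq /andP[Ip Fq]]|[p [q [Ip Fq rpq]]]].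
  by exists p, q.
by exists (p, q); rewrite //= Ip.
Qed.

End Relations.

(** * Labelled paths and the conditions on a certificate *)

Section Automaton.

Variables (A : finType) (Q : countType) (tr : seq (letter A * (Q * Q))).

Fixpoint run p (w : seq (letter A)) q : Prop :=
  if w is x :: w' then exists2 r, (x, (p, r)) \in tr & run r w' q else p = q.

Definition reach p (g : freegroup A) q := exists2 w, run p w q & fgproj w = g.

Definition accepts (IF : seq Q * seq Q) g :=
  exists p q, [/\ p \in IF.1, q \in IF.2 & reach p g q].

Lemma run_cat p r q u v : run p u r -> run r v q -> run p (u ++ v) q.
Proof.
elim: u p => [|x u IHu] p /=; first by move->.
by case=> s ps su rv; exists s; last exact: IHu.
Qed.

Lemma reach1 p : reach p 1%g p.
Proof. by exists [::]. Qed.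

Lemma reachM p r q g h : reach p g r -> reach r h q -> reach p (g * h)%g q.
Proof.
case=> u pu <- [v rv <-]; exists (u ++ v); last by rewrite fgproj_cat.
exact: run_cat pu rv.
Qed.

Definition label_rel (D : seq (letter A * (Q * Q))) x :=
  [seq d.2 | d <- [seq d <- D | d.1 == x]].

Lemma mem_label_rel D x e : (e \in label_rel D x) = ((x, e) \in D).
Proof.
apply/mapP/idP => [[[y e']]|Dxe].
  by rewrite mem_filter /= => /andP[/eqP-> ?] ->.
by exists (x, e); rewrite // mem_filter eqxx.
Qed.

(* [E] and [D] bound the pairs of states joined by a path whose label reduces
   to the empty word, respectively to a single letter. *)
Definition saturated (S : seq Q) (E : seq (Q * Q)) D :=
  [&& all (fun p => (p, p) \in E) S, all (fun d => d.2.2 \in S) D,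
      all (fun d => d \in D) tr, sub_rel (comp_rel E E) E
    & all (fun x => sub_rel (comp_rel E (label_rel D x)) (label_rel D x) &&
        sub_rel (comp_rel (label_rel D x) (label_rel D (linv x))) E)
        (enum {: letter A})].

(* The relations on states induced by a word and by its inverse. *)
Definition profile : countType := (seq (Q * Q) * seq (Q * Q))%type.

(** Closure under prepending a letter makes [X] bound the profile of every word. In the inverse word
    the letter is appended; the trailing [E] is there because [saturated] lets letters absorb empty
    steps on their left only. *)
Definition profiles_closed E D (X : seq profile) :=
  has (fun t => sub_rel E t.1 && sub_rel E t.2) X &&
  all (fun t => all (fun x => has (fun t' =>
      sub_rel (comp_rel (label_rel D x) t.1) t'.1 &&
      sub_rel (comp_rel t.2 (comp_rel (label_rel D (linv x)) E)) t'.2) X)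
    (enum {: letter A})) X.

(** The alternatives are the two orientations in [conjugate_conj_form]; the inverse of a product is
    read through the inverse relations in reverse order. *)
Definition core_matches (I1 I2 : seq Q * seq Q) (w v p q : profile) :=
  links I2.1 (comp_rel w.1 (comp_rel (comp_rel p.1 q.1) w.2)) I2.2 &&
    links I1.1 (comp_rel v.1 (comp_rel (comp_rel q.1 p.1) v.2)) I1.2 ||
  links I2.1 (comp_rel w.1 (comp_rel (comp_rel q.2 p.2) w.2)) I2.2 &&
    links I1.1 (comp_rel v.1 (comp_rel (comp_rel p.2 q.2) v.2)) I1.2.

(* [z] bounds the powers of [p ++ q]: it stands for the unbounded exponent of
   [conj_form]. *)
Definition conjugator_misses E (I0 : seq Q * seq Q) (Z : seq (seq (Q * Q)))
    (w v p q : profile) :=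
  has (fun z => [&& sub_rel E z,
      sub_rel (comp_rel z (comp_rel p.1 q.1)) z
    & ~~ links I0.1 (comp_rel w.1 (comp_rel z (comp_rel p.1 v.2))) I0.2]) Z.

(** The first conjunct treats trivial [x2], which the normal form does not cover: then [x1] is
    trivial and [u] is arbitrary. *)
Definition refutes E (X : seq profile) Z (I0 I1 I2 : seq Q * seq Q) :=
  ~~ [&& links I1.1 E I1.2, links I2.1 E I2.2
       & has (fun t : profile => links I0.1 t.1 I0.2) X] &&
  all (fun w => all (fun v => all (fun p => all (fun q =>
    core_matches I1 I2 w v p q ==> conjugator_misses E I0 Z w v p q) X) X) X) X.

(** * Soundness of certificates *)

Section Saturated.

Variables (S : seq Q) (E : seq (Q * Q)) (D : seq (letter A * (Q * Q))).
Variable X : seq profile.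
Hypothesis satED : saturated S E D.

(** One [E] step at the end suffices, as those in front of a letter are absorbed by [sat_labelE]. *)
Fixpoint chain p (w : seq (letter A)) q : Prop :=
  if w is x :: w' then exists2 r, (x, (p, r)) \in D & chain r w' q
  else (p, q) \in E.

Lemma sat_refl p : p \in S -> (p, p) \in E.
Proof. by case/and5P: satED => /allP h _ _ _ _; apply: h. Qed.

Lemma sat_target x p q : (x, (p, q)) \in D -> q \in S.
Proof. by case/and5P: satED => _ /allP h _ _ _ /h. Qed.

Lemma sat_trans p r q : (p, r) \in E -> (r, q) \in E -> (p, q) \in E.
Proof.
by case/and5P: satED => _ _ _ /sub_relP h _ Epr Erq; apply/h/comp_relP; exists r.
Qed.

Lemma sat_labelE x p r q :
  (p, r) \in E -> (x, (r, q)) \in D -> (x, (p, q)) \in D.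
Proof.
case/and5P: satED => _ _ _ _ /allP/(_ x); rewrite mem_enum => /(_ isT).
move=> /andP[/sub_relP h _] Epr Drq; rewrite -mem_label_rel.
by apply/h/comp_relP; exists r; rewrite // mem_label_rel.
Qed.

Lemma sat_cancel x p r q :
  (x, (p, r)) \in D -> (linv x, (r, q)) \in D -> (p, q) \in E.
Proof.
case/and5P: satED => _ _ _ _ /allP/(_ x); rewrite mem_enum => /(_ isT).
move=> /andP[_ /sub_relP h] Dpr Drq.
by apply/h/comp_relP; exists r; rewrite // mem_label_rel.
Qed.

Lemma chainE p r w q : (p, r) \in E -> chain r w q -> chain p w q.
Proof.
case: w => [|x w] /= Epr; first exact: sat_trans.
by case=> s Drs ws; exists s; first exact: sat_labelE Drs.
Qed.

Lemma chain_push x p r w q :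
  (x, (p, r)) \in D -> chain r w q -> chain p (push x w) q.
Proof.
move=> Dpr; case: w => [|y w] /=; first by exists r.
case=> s Drs ws; case: eqP => [ey|_] /=; last by exists r => //; exists s.
by rewrite ey in Drs; apply: chainE ws; apply: sat_cancel Dpr Drs.
Qed.

(** Each pair of letters cancelled by the reduction becomes an [E] step, absorbed by what
    follows. *)
Lemma chain_run p w q : q \in S -> run p w q -> chain p (reduce w) q.
Proof.
move=> Sq; elim: w p => [|x w IHw] p /=; first by move->; apply: sat_refl.
case=> r tr_pr /IHw; apply: chain_push.
by case/and5P: satED => _ _ /allP h _ _; apply: h.
Qed.

(** The first factor needs a closing [E] step of its own; reflexivity at the cut state, which lies
    in [S], supplies it. *)
Lemma chain_cat p u v q : p \in S ->
  chain p (u ++ v) q -> exists r, [/\ r \in S, chain p u r & chain r v q].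
Proof.
elim: u p => [|x u IHu] p Sp /=.
  by move=> pv; exists p; split=> //; apply: sat_refl.
case=> r Dpr /(IHu _ (sat_target Dpr))[s [Ss ru sv]].
by exists s; split=> //; exists r.
Qed.

Definition covers (r : seq (Q * Q)) w :=
  forall p q, p \in S -> chain p w q -> (p, q) \in r.

Lemma covers_cat r1 r2 u v :
  covers r1 u -> covers r2 v -> covers (comp_rel r1 r2) (u ++ v).
Proof.
move=> r1u r2v p q Sp /(chain_cat Sp)[s [Ss pu sv]].
by apply/comp_relP; exists s; [apply: r1u | apply: r2v].
Qed.

(** Closure under appending the core is an inductive invariant, so one finite relation handles the
    unbounded exponent. *)
Lemma covers_pow z r c k : sub_rel E z -> sub_rel (comp_rel z r) z ->
  covers r c -> covers z (word_pow k c).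
Proof.
move=> /sub_relP Ez /sub_relP zr rc; elim: k => [|k IHk].
  by move=> p q _; apply: Ez.
by rewrite word_powSr => p q Sp pq; apply/zr/(covers_cat IHk rc Sp pq).
Qed.

Hypothesis closedX : profiles_closed E D X.

Lemma profile_covers w :
  exists2 t, t \in X & covers t.1 w /\ covers t.2 (winv w).
Proof.
case/andP: closedX => /hasP[t0 Xt0 /andP[/sub_relP E1 /sub_relP E2]] /allP cX.
elim: w => [|x w [t Xt [tw tw']]].
  by exists t0 => //; split=> p q _; [apply: E1 | apply: E2].
have /allP/(_ x) := cX t Xt; rewrite mem_enum => /(_ isT).
case/hasP=> t' Xt' /andP[/sub_relP c1 /sub_relP c2]; exists t' => //.
split=> p q Sp; last rewrite winv_cons -cats1.
  case=> r Dpr rw; apply/c1/comp_relP; exists r; first by rewrite mem_label_rel.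
  exact: tw (sat_target Dpr) rw.
move=> pwq; apply: c2; apply: (covers_cat tw' _ Sp pwq) => {Sp pwq} r s Sr [r' Dr Er].
by apply/comp_relP; exists r'; rewrite // mem_label_rel.
Qed.

(** Acceptance yields a chain on the reduced word, so a literal factorisation of that word can be
    bounded factor by factor. *)
Lemma accepts_links IF g r w : {subset IF.1 <= S} -> {subset IF.2 <= S} ->
  accepts IF g -> fgword g = w -> covers r w -> links IF.1 r IF.2.
Proof.
move=> sIS sFS [p [q [Ip Fq [w' pwq <-]]]] <- rw; apply/linksP; exists p, q.
by split=> //; apply: (rw _ _ (sIS p Ip)); apply: chain_run (sFS q Fq) pwq.
Qed.

Lemma refutes_sound Z (IF0 IF1 IF2 : seq Q * seq Q) u x1 x2 :
  (forall IF, IF \in [:: IF0; IF1; IF2] ->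
     {subset IF.1 <= S} /\ {subset IF.2 <= S}) ->
  refutes E X Z IF0 IF1 IF2 ->
  accepts IF0 u -> accepts IF1 x1 -> accepts IF2 x2 ->
  x1 <> (u^-1 * x2 * u)%g.
Proof.
move=> sub_IF /andP[noX noXX] acc0 acc1 acc2 ex1.
have [sI0 sF0] := sub_IF IF0 (mem_head _ _).
have /sub_IF[sI1 sF1] : IF1 \in [:: IF0; IF1; IF2] by rewrite !inE eqxx orbT.
have /sub_IF[sI2 sF2] : IF2 \in [:: IF0; IF1; IF2] by rewrite !inE eqxx !orbT.
have [x2_1|nx2] := eqVneq (fgword x2) [::].
  have {}x2_1 : x2 = 1%g by apply: val_inj.
  have [t Xt [tu _]] := profile_covers u.
  case/negP: noX; apply/and3P; split.
  - apply: (accepts_links sI1 sF1 acc1 (w := [::])) => //.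
    by rewrite ex1 x2_1 mulg1 mulVg.
  - by apply: (accepts_links sI2 sF2 acc2 (w := [::])); rewrite // x2_1.
  - by apply/hasP; exists t => //; apply: (accepts_links sI0 sF0 acc0).
have form := conjugate_conj_form (fgwordP u) (fgwordP x1) (fgwordP x2) nx2.
rewrite !fgprojK in form; have {form} := form ex1.
(* Both orientations share the factorisation of [u], so either way a matching core contradicts
   [conjugator_misses]. *)
have miss w v p q k : fgword u = w ++ word_pow k (p ++ q) ++ p ++ winv v ->
    exists tw tv tp tq, [/\ covers tw.1 w /\ covers tw.2 (winv w),
      covers tv.1 v /\ covers tv.2 (winv v), covers tp.1 p /\ covers tp.2 (winv p),
      covers tq.1 q /\ covers tq.2 (winv q) & ~~ core_matches IF1 IF2 tw tv tp tq].
  move=> eu; have [tw Xw cw] := profile_covers w.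
  have [tv Xv cv] := profile_covers v; have [tp Xp cp] := profile_covers p.
  have [tq Xq cq] := profile_covers q; exists tw, tv, tp, tq; split=> //.
  have /implyP cm := allP (allP (allP (allP noXX tw Xw) tv Xv) tp Xp) tq Xq.
  apply/negP => /cm/hasP[z _ /and3P[Ez zpq /negP[]]].
  apply: (accepts_links sI0 sF0 acc0 eu).
  apply: covers_cat cw.1 (covers_cat (covers_pow Ez zpq _) _).
    exact: covers_cat cp.1 cq.1.
  exact: covers_cat cp.1 cv.2.
case=> [] [w [v [p [q [k [eu ex2 {}ex1]]]]]].
  have [tw [tv [tp [tq [cw cv cp cq]]]]] := miss _ _ _ _ _ eu.
  case/norP=> /negP[]; apply/andP; split.
    apply: (accepts_links sI2 sF2 acc2 ex2).
    exact: covers_cat cw.1 (covers_cat (covers_cat cp.1 cq.1) cw.2).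
  apply: (accepts_links sI1 sF1 acc1 ex1).
  exact: covers_cat cv.1 (covers_cat (covers_cat cq.1 cp.1) cv.2).
have [tw [tv [tp [tq [cw cv cp cq]]]]] := miss _ _ _ _ _ eu.
case/norP=> _ /negP[]; apply/andP; split.
  apply: (accepts_links sI2 sF2 acc2 (canRL (@winvK A) ex2)).
  rewrite !winv_cat winvK -[_ ++ winv w]catA catA -catA.
  exact: covers_cat cw.1 (covers_cat (covers_cat cq.2 cp.2) cw.2).
apply: (accepts_links sI1 sF1 acc1 (canRL (@winvK A) ex1)).
rewrite !winv_cat winvK -catA.
exact: covers_cat cv.1 (covers_cat (covers_cat cp.2 cq.2) cv.2).
Qed.

End Saturated.

(** * Completeness: unsolvable instances have certificates *)

Section Completeness.

Local Open Scope group_scope.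

Variable S : seq Q.
Hypothesis tr_S : forall x p q, (x, (p, q)) \in tr -> p \in S /\ q \in S.

Definition rel_of (P : Q -> Q -> Prop) : seq (Q * Q) :=
  [seq e <- [seq (p, q) | p <- S, q <- S] | boolp.asbool (P e.1 e.2)].

Lemma rel_ofP P p q :
  (p, q) \in rel_of P <-> [/\ p \in S, q \in S & P p q].
Proof.
rewrite mem_filter /=; split.
  case/andP=> /boolp.asboolP Ppq /allpairsP[[p1 q1] /= [Sp Sq [ep eq]]].
  by rewrite ep eq in Ppq *.
case=> Sp Sq Ppq; apply/andP; split; first exact/boolp.asboolP.
by apply/allpairsP; exists (p, q).
Qed.

(** Applied to the list of all pairs of states, this contains every value of [rel_of], so only
    finitely many relations occur. *)
Definition subseqs (T : eqType) (s : seq T) :=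
  [seq mask (tval m) s | m <- enum {: (size s).-tuple bool}].

Lemma filter_subseqs (T : eqType) (a : pred T) (s : seq T) :
  filter a s \in subseqs s.
Proof.
apply/mapP; exists [tuple of map a (in_tuple s)]; first by rewrite mem_enum.
exact: filter_mask.
Qed.

(** Values not attained are dropped: [refutes] quantifies over all of [X], so each entry must come
    from a group element. *)
Lemma finite_range (G : Type) (U : eqType) (f : G -> U) (Y : seq U) :
  (forall g, f g \in Y) ->
  exists X : seq U,
    (forall g, f g \in X) /\ (forall t, t \in X -> exists g, t = f g).
Proof.
move=> fY; exists [seq t <- Y | boolp.asbool (exists g, t = f g)]; split.
  by move=> g; rewrite mem_filter fY andbT; apply/boolp.asboolP; exists g.
by move=> t; rewrite mem_filter => /andP[/boolp.asboolP].
Qed.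

(** The lower bound dual to [covers], for group elements instead of words. *)
Definition within (r : seq (Q * Q)) g :=
  forall p q, (p, q) \in r -> reach p g q.

Lemma within_comp r1 r2 g h :
  within r1 g -> within r2 h -> within (comp_rel r1 r2) (g * h).
Proof.
by move=> r1g r2h p q /comp_relP[s /r1g ps /r2h]; apply: reachM.
Qed.

Lemma links_accepts IF r g : within r g -> links IF.1 r IF.2 -> accepts IF g.
Proof.
by move=> rg /linksP[p [q [Ip Fq /rg pq]]]; exists p, q.
Qed.

Definition reach_rel g := rel_of (fun p q => reach p g q).

Lemma reach_relP g p q :
  (p, q) \in reach_rel g <-> [/\ p \in S, q \in S & reach p g q].
Proof. exact: rel_ofP. Qed.

Lemma within_reach_rel g : within (reach_rel g) g.
Proof. by move=> p q /reach_relP[]. Qed.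

Lemma comp_reach_rel g h :
  sub_rel (comp_rel (reach_rel g) (reach_rel h)) (reach_rel (g * h)).
Proof.
apply/sub_relP => -[p q] /comp_relP[s /reach_relP[Sp _ ps] /reach_relP[_ Sq sq]].
by apply/reach_relP; split=> //; apply: reachM ps sq.
Qed.

Lemma conj_core (w v p q : freegroup A) k :
  let u := w * ((p * q) ^+ k * (p * v^-1)) in
  v * ((q * p) * v^-1) = u^-1 * (w * ((p * q) * w^-1)) * u.
Proof.
move=> u; apply: (mulgI u); rewrite -(mulgA u^-1) mulVKg {}/u -!mulgA !mulKg.
rewrite !(mulgA p q); move: (p * q) => c; congr (w * _).
by rewrite !mulgA -expgSr -expgS.
Qed.

Lemma refutation_complete (IF0 IF1 IF2 : seq Q * seq Q) :
  (forall u x1 x2, accepts IF0 u -> accepts IF1 x1 -> accepts IF2 x2 ->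
     x1 <> u^-1 * x2 * u) ->
  exists E D X Z,
    [/\ saturated S E D, profiles_closed E D X & refutes E X Z IF0 IF1 IF2].
Proof.
move=> noP; pose E := reach_rel 1.
pose D : seq (letter A * (Q * Q)) :=
  flatten [seq [seq (x, e) | e <- reach_rel (fgproj [:: x])]
          | x <- enum {: letter A}].
have memD x e : ((x, e) \in D) = (e \in reach_rel (fgproj [:: x])).
  apply/flattenP/idP => [[_ /mapP[y _ ->] /mapP[e' re' [-> ->]]] //|re].
  exists [seq (x, e) | e <- reach_rel (fgproj [:: x])].
    by apply/mapP; exists x; rewrite ?mem_enum.
  by apply/mapP; exists e.
have labD x : label_rel D x =i reach_rel (fgproj [:: x]).
  by move=> e; rewrite mem_label_rel memD.
pose f g : profile := (reach_rel g, reach_rel g^-1).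
pose S2 := [seq (p, q) | p <- S, q <- S].
have [X [Xf fX]] : exists X : seq profile, (forall g, f g \in X) /\
    (forall t, t \in X -> exists g, t = f g).
  apply: (@finite_range _ _ f [seq (a, b) | a <- subseqs S2, b <- subseqs S2]).
  move=> g; apply/allpairsP; exists (f g); split=> //; exact: filter_subseqs.
(* The union over all exponents of the relations of [g ^+ k]: closed under a further factor [g], and
   each of its pairs comes from an actual exponent. *)
pose z g := rel_of (fun p q => exists k, reach p (g ^+ k) q).
have [Z [Zz _]] : exists Z : seq (seq (Q * Q)), (forall g, z g \in Z) /\
    (forall t, t \in Z -> exists g, t = z g).
  by apply: (@finite_range _ _ z (subseqs S2)) => g; apply: filter_subseqs.
exists E, D, X, Z; split.
- apply/and5P; split.
  + by apply/allP => p Sp; apply/reach_relP; split=> //; apply: reach1.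
  + by apply/allP => -[x [p q]]; rewrite memD => /reach_relP[].
  + apply/allP => -[x [p q]] tr_pq; rewrite memD; apply/reach_relP.
    have [Sp Sq] := tr_S tr_pq; split=> //.
    by exists [:: x] => //=; exists q.
  + by have := comp_reach_rel 1 1; rewrite mulg1.
  apply/allP => x _; apply/andP; split; apply/sub_relP => -[p q] /comp_relP[s].
    move=> Eps; rewrite !labD => xsq.
    have /sub_relP sub := comp_reach_rel 1 (fgproj [:: x]).
    by rewrite mul1g in sub; apply/sub/comp_relP; exists s.
  rewrite !labD => xps xsq.
  have /sub_relP sub := comp_reach_rel (fgproj [:: x]) (fgproj [:: linv x]).
  rewrite fgproj_linv mulgV in sub.
  by apply/sub/comp_relP; exists s; rewrite -?fgproj_linv.
- apply/andP; split.
    apply/hasP; exists (f 1); first exact: Xf.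
    by rewrite /f /= invg1; apply/andP; split; apply/sub_relP.
  apply/allP => _ /fX[g ->]; apply/allP => x _; apply/hasP.
  exists (f (fgproj [:: x] * g)); first exact: Xf.
  apply/andP; split; apply/sub_relP => -[p q] /comp_relP[s].
    rewrite labD => xps gsq.
    by apply/(sub_relP _ _ (comp_reach_rel _ _))/comp_relP; exists s.
  move=> gps /comp_relP[s']; rewrite labD => xss Es.
  rewrite /= invgM -fgproj_linv; apply/(sub_relP _ _ (comp_reach_rel _ _))/comp_relP.
  exists s => //; rewrite -[fgproj _]mulg1.
  by apply/(sub_relP _ _ (comp_reach_rel _ _))/comp_relP; exists s'.
apply/andP; split.
  apply/negP => /and3P[l1 l2 /hasP[_ /fX[g ->] l0]].
  have := noP g 1 1 (links_accepts (@within_reach_rel g) l0)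
    (links_accepts (@within_reach_rel 1) l1) (links_accepts (@within_reach_rel 1) l2).
  by rewrite mulg1 mulVg.
apply/allP => _ /fX[w ->]; apply/allP => _ /fX[v ->].
apply/allP => _ /fX[p ->]; apply/allP => _ /fX[q ->]; apply/implyP => core.
apply/hasP; exists (z (p * q)) => //; apply/and3P; split.
- apply/sub_relP => -[s t] /reach_relP[Ss St st]; apply/rel_ofP; split=> //.
  by exists 0%N.
- apply/sub_relP => -[s t] /comp_relP[r /rel_ofP[Ss Sr [k sr]]].
  case/comp_relP=> r' /reach_relP[_ _ rr] /reach_relP[_ St rt].
  apply/rel_ofP; split=> //; exists k.+1; rewrite expgSr.
  exact: reachM sr (reachM rr rt).
apply/negP => l0.
have wi g := @within_reach_rel g.
have [k acc0] : exists k, accepts IF0 (w * ((p * q) ^+ k * (p * v^-1))).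
  case/linksP: l0 => a [b [Ia Fb /comp_relP[c /wi ac /comp_relP[d]]]].
  case/rel_ofP=> _ _ [k cd] /comp_relP[e /wi de /wi eb]; exists k, a, b; split=> //.
  exact: reachM ac (reachM cd (reachM de eb)).
case/orP: core => /andP[l2 l1].
  apply: (noP _ _ _ acc0 (links_accepts _ l1) (links_accepts _ l2)
    (conj_core w v p q k)).
    exact: within_comp (wi v) (within_comp (within_comp (wi q) (wi p)) (wi _)).
  exact: within_comp (wi w) (within_comp (within_comp (wi p) (wi q)) (wi _)).
have core_inv : v * ((p^-1 * q^-1) * v^-1) =
    (w * ((p * q) ^+ k * (p * v^-1)))^-1 * (w * ((q^-1 * p^-1) * w^-1)) *
    (w * ((p * q) ^+ k * (p * v^-1))).
  have /= := conj_core w v p q k; move: (w * (_ ^+ k * _)) => u eq_core.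
  by apply: invg_inj; rewrite !invgM !invgK !mulgA in eq_core *.
apply: (noP _ _ _ acc0 (links_accepts _ l1) (links_accepts _ l2) core_inv).
  exact: within_comp (wi v) (within_comp (within_comp (wi _) (wi _)) (wi _)).
exact: within_comp (wi w) (within_comp (within_comp (wi _) (wi _)) (wi _)).
Qed.

End Completeness.
End Automaton.

(** * The two checkers for a triple of automata *)

Section Instance.

Variable A : finType.
Implicit Types (M : fsa A) (w : seq (letter A)).

(** The subset construction, tracking all current states of a nondeterministic run. *)
Definition fsa_step M (s : seq nat) (x : letter A) :=
  [seq t.2 | t <- [seq t <- fsa_trans M | (t.1.2 == x) && (t.1.1 \in s)]].

Definition fsa_acceptsb M w :=
  has (fun p => p \in fsa_final M) (foldl (fsa_step M) (fsa_init M) w).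

Lemma fsa_acceptsP M w : reflect (fsa_lang M w) (fsa_acceptsb M w).
Proof.
rewrite /fsa_lang /fsa_acceptsb; move: (fsa_init M).
elim: w => [|x w IHw] s /=; first exact: hasP.
apply: (iffP (IHw _)) => [[q]|[p sp [q pq qw]]].
  case/mapP=> [[[p y] r]]; rewrite mem_filter /= => /andP[/andP[/eqP-> sp] tr_pr] ->.
  by move=> rw; exists p => //; exists r.
exists q => //; apply/mapP; exists (p, x, q) => //.
by rewrite mem_filter /= eqxx sp.
Qed.

(* The three automata become disjoint copies inside a single one. *)
Definition tag_states (i : nat) (s : seq nat) := [seq (i, p) | p <- s].

Definition tag_ends i M :=
  (tag_states i (fsa_init M), tag_states i (fsa_final M)).

Definition tag_trans i M : seq (letter A * ((nat * nat) * (nat * nat))) :=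
  [seq (t.1.2, ((i, t.1.1), (i, t.2))) | t <- fsa_trans M].

Definition union_trans (M : fsa A * fsa A * fsa A) :=
  tag_trans 0 M.1.1 ++ tag_trans 1 M.1.2 ++ tag_trans 2 M.2.

Lemma tag_transP i M x p q :
  reflect [/\ p.1 = i, q.1 = i & (p.2, x, q.2) \in fsa_trans M]
    ((x, (p, q)) \in tag_trans i M).
Proof.
apply: (iffP mapP) => [[[[p0 y] q0] tr_pq [-> -> ->]] //|].
by case: p q => [_ p] [_ q] [/= -> -> tr_pq]; exists (p, x, q).
Qed.

Lemma tag_statesP i s p : reflect (p.1 = i /\ p.2 \in s) (p \in tag_states i s).
Proof.
apply: (iffP mapP) => [[q sq ->] //|].
by case: p => [_ p] [/= -> sp]; exists p.
Qed.

(** A run starting in copy [i] never leaves it, so agreement on the transitions out of that copy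
    suffices. *)
Lemma accepts_tag (tr : seq (letter A * ((nat * nat) * (nat * nat)))) i M g :
  (forall x p q, p.1 = i ->
     ((x, (p, q)) \in tr) = ((x, (p, q)) \in tag_trans i M)) ->
  rational_subset M g <-> accepts tr (tag_ends i M) g.
Proof.
move=> tr_i; have runE w p : (exists2 q, q \in tag_states i (fsa_final M) &
    run tr (i, p) w q) <-> fsa_accepts_from M p w.
  elim: w p => [|x w IHw] p /=; split.
  - by case=> q /tag_statesP[_ Fq] eq; rewrite -eq in Fq.
  - by move=> Fp; exists (i, p) => //; apply/tag_statesP.
  - case=> q Fq [r]; rewrite tr_i // => /tag_transP[_ er tr_pr] rq.
    exists r.2 => //; apply/IHw; exists q => //.
    by rewrite -er -surjective_pairing.
  - case=> r tr_pr /IHw[q Fq rq]; exists q => //; exists (i, r) => //.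
    by rewrite tr_i //; apply/tag_transP.
split.
  case=> w [p Ip /runE[q Fq pq]] <-; exists (i, p), q; split=> //=.
    by apply/tag_statesP.
  by exists w.
case=> [[_ p] [q [/tag_statesP[/= -> Ip] Fq [w pq <-]]]]; exists w => //.
by exists p => //; apply/runE; exists q.
Qed.

Lemma accepts_union (M : fsa A * fsa A * fsa A) g :
  [/\ rational_subset M.1.1 g <-> accepts (union_trans M) (tag_ends 0 M.1.1) g,
      rational_subset M.1.2 g <-> accepts (union_trans M) (tag_ends 1 M.1.2) g
    & rational_subset M.2 g <-> accepts (union_trans M) (tag_ends 2 M.2) g].
Proof.
have no i j N x p q : p.1 = i -> i != j -> ((x, (p, q)) \in tag_trans j N) = false.
  by move=> <- nij; apply/negP => /tag_transP[ep]; rewrite ep eqxx in nij.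
split; apply: accepts_tag => x p q ep; rewrite !mem_cat.
- by rewrite (no 0 1) // (no 0 2) // !orbF.
- by rewrite (no 1 0) // (no 1 2) // orbF.
- by rewrite (no 2 0) // (no 2 1).
Qed.

(** The equation is tested as [u x1 = x2 u], which avoids inverses. *)
Definition solves (c : (fsa A * fsa A * fsa A) *
    (seq (letter A) * seq (letter A) * seq (letter A))) :=
  [&& fsa_acceptsb c.1.1.1 c.2.1.1, fsa_acceptsb c.1.1.2 c.2.1.2,
      fsa_acceptsb c.1.2 c.2.2
    & reduce (c.2.1.1 ++ c.2.1.2) == reduce (c.2.2 ++ c.2.1.1)].

Lemma solvesP (M : fsa A * fsa A * fsa A) :
  gen_conjugate (rational_subset M.1.1) (rational_subset M.1.2)
    (rational_subset M.2) <-> exists c, solves (M, c).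
Proof.
split.
  case=> _ [_ [_ [[w0 acc0 <-] [w1 acc1 <-] [w2 acc2 <-] eq]]].
  exists (w0, w1, w2); apply/and4P; split; try exact/fsa_acceptsP.
  apply/eqP; rewrite -[LHS]/(fgword (fgproj (w0 ++ w1))).
  by rewrite fgproj_cat eq !mulgA mulgV mul1g -fgproj_cat.
case=> [[[w0 w1] w2]] /and4P[/fsa_acceptsP a0 /fsa_acceptsP a1 /fsa_acceptsP a2].
move=> /eqP eq; exists (fgproj w0), (fgproj w1), (fgproj w2).
split; [by exists w0 | by exists w1 | by exists w2 |].
rewrite -mulgA -(fgproj_cat w2).
have -> : fgproj (w2 ++ w0) = fgproj (w0 ++ w1) by apply: val_inj.
by rewrite fgproj_cat mulKg.
Qed.

Definition state : countType := (nat * nat)%type.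
Definition certificate : countType :=
  (seq state * seq (state * state) * seq (letter A * (state * state)) *
   seq (profile state) * seq (seq (state * state)))%type.

Definition refuted (c : (fsa A * fsa A * fsa A) * certificate) :=
  let: (M, (St, E, D, X, Z)) := c in
  let IF0 := tag_ends 0 M.1.1 in
  let IF1 := tag_ends 1 M.1.2 in
  let IF2 := tag_ends 2 M.2 in
  [&& all (fun p => p \in St)
        (IF0.1 ++ IF0.2 ++ IF1.1 ++ IF1.2 ++ IF2.1 ++ IF2.2),
      saturated (union_trans M) St E D, profiles_closed E D X
    & refutes E X Z IF0 IF1 IF2].

Lemma refutedP (M : fsa A * fsa A * fsa A) :
  ~ gen_conjugate (rational_subset M.1.1) (rational_subset M.1.2)
    (rational_subset M.2) <-> exists c, refuted (M, c).
Proof.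
split; last first.
  case=> [[[[[S E] D] X] Z]] /and4P[/allP sS satED closedX ref].
  case=> u [x1 [x2 [K0u K1x1 K2x2]]].
  have [[a0 _] _ _] := accepts_union M u.
  have [_ [a1 _] _] := accepts_union M x1.
  have [_ _ [a2 _]] := accepts_union M x2.
  apply: (refutes_sound satED closedX _ ref (a0 K0u) (a1 K1x1) (a2 K2x2)).
  move=> IF; rewrite !inE => /or3P[]/eqP->; split=> p IFp; apply: sS;
    by rewrite !mem_cat IFp ?orbT.
move=> noP; pose ends := tag_states 0 (fsa_init M.1.1) ++
  tag_states 0 (fsa_final M.1.1) ++ tag_states 1 (fsa_init M.1.2) ++
  tag_states 1 (fsa_final M.1.2) ++ tag_states 2 (fsa_init M.2) ++
  tag_states 2 (fsa_final M.2).
(* The checker asks for the endpoints, and [refutation_complete] for both ends of every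
   transition. *)
pose S := ends ++ [seq d.2.1 | d <- union_trans M] ++
  [seq d.2.2 | d <- union_trans M].
have trS x p q : (x, (p, q)) \in union_trans M -> p \in S /\ q \in S.
  by move=> tr_pq; split; rewrite !mem_cat; apply/orP; right; apply/orP;
    [left | right]; apply/mapP; exists (x, (p, q)).
have [u x1 x2 a0 a1 a2 ex1|E [D [X [Z [satED closedX ref]]]]] :=
  @refutation_complete _ _ _ S trS (tag_ends 0 M.1.1) (tag_ends 1 M.1.2)
    (tag_ends 2 M.2).
  apply: noP; exists u, x1, x2.
  have [[_ h0] _ _] := accepts_union M u.
  have [_ [_ h1] _] := accepts_union M x1.
  have [_ _ [_ h2]] := accepts_union M x2.
  by split; [apply: h0 | apply: h1 | apply: h2 |].
exists (S, E, D, X, Z); apply/and4P; split=> //.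
by apply/allP => p ends_p; rewrite mem_cat ends_p.
Qed.

End Instance.

(** * Computability of the checkers *)

Lemma computable_comp2 (T U V W : countType) (f : U -> V -> W) (g : T -> U)
    (h : T -> V) :
  computable (fun c => f c.1 c.2) -> computable g -> computable h ->
  computable (fun t => f (g t) (h t)).
Proof.
move=> cf cg ch.
exact: (computable_comp (g := fun t => (g t, h t)) cf (computable_pair cg ch)).
Qed.

Ltac computability_step := lazymatch goal with
  | |- computable (fun _ => ?c) => exact: computable_const
  | |- computable (fun t => t) => exact: computable_id
  | |- computable (fun _ => _ && _) => apply: computable_and
  | |- computable (fun _ => _ || _) => apply: computable_or
  | |- computable (fun _ => _ ==> _) => apply: computable_impl
  | |- computable (fun _ => ~~ _) => apply: computable_negb
  | |- computable (fun _ => _ == _) => apply: computable_eq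
  | |- computable (fun _ => _ \in _) => apply: computable_mem
  | |- computable (fun _ => all _ _) => apply: computable_all
  | |- computable (fun _ => has _ _) => apply: computable_has
  | |- computable (fun _ => flatten (map _ _)) => apply: computable_flatten_map
  | |- computable (fun _ => map _ _) => apply: computable_map
  | |- computable (fun _ => filter _ _) => apply: computable_filter
  | |- computable (fun _ => _ ++ _) => apply: computable_cat
  | |- computable (fun _ => (_, _)) => apply: computable_pair
  | |- computable fst => exact: computable_fst (computable_id _)
  | |- computable snd => exact: computable_snd (computable_id _)
  | |- computable (fun _ => _.1) => apply: computable_fst
  | |- computable (fun _ => _.2) => apply: computable_snd
  end.

Ltac computability := repeat computability_step.

Section CheckerComputability.

Variables (A : finType) (Q : countType).

Lemma computable_comp_rel (T : countType) (r1 r2 : T -> seq (Q * Q)) :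
  computable r1 -> computable r2 ->
  computable (fun t => comp_rel (r1 t) (r2 t)).
Proof.
by apply: (computable_comp2 (f := @comp_rel Q)); rewrite /comp_rel; computability.
Qed.

Lemma computable_sub_rel (T : countType) (r1 r2 : T -> seq (Q * Q)) :
  computable r1 -> computable r2 ->
  computable (fun t => sub_rel (r1 t) (r2 t)).
Proof.
by apply: (computable_comp2 (f := @sub_rel Q)); rewrite /sub_rel; computability.
Qed.

Lemma computable_links (T : countType) (I : T -> seq Q)
    (r : T -> seq (Q * Q)) (F : T -> seq Q) :
  computable I -> computable r -> computable F ->
  computable (fun t => links (I t) (r t) (F t)).
Proof.
move=> cI cr cF.
apply: (computable_comp2 (f := fun I c => links I c.1 c.2)
  (h := fun t => (r t, F t))) => //; last exact: computable_pair.
by rewrite /links; computability.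
Qed.

Lemma computable_label_rel (T : countType)
    (D : T -> seq (letter A * (Q * Q))) (x : T -> letter A) :
  computable D -> computable x ->
  computable (fun t => label_rel (D t) (x t)).
Proof.
by apply: (computable_comp2 (f := @label_rel A Q)); rewrite /label_rel; computability.
Qed.

Lemma computable_linv (T : countType) (x : T -> letter A) :
  computable x -> computable (fun t => linv (x t)).
Proof. exact: computable_comp (computable_finType _). Qed.

(** Automata inherit their codes from [fsa_tuple], so the same [F] works. *)
Lemma computable_fsa_tuple (T : countType) (M : T -> fsa A) :
  computable M -> computable (fun t => fsa_tuple (M t)).
Proof. by []. Qed.

Lemma computable_fsa_init (T : countType) (M : T -> fsa A) :
  computable M -> computable (fun t => fsa_init (M t)).
Proof.
by move=> /computable_fsa_tuple cM; apply: (computable_fst (computable_fst cM)). Qed.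

Lemma computable_fsa_final (T : countType) (M : T -> fsa A) :
  computable M -> computable (fun t => fsa_final (M t)).
Proof.
by move=> /computable_fsa_tuple cM; apply: (computable_snd (computable_fst cM)).
Qed.

Lemma computable_fsa_trans (T : countType) (M : T -> fsa A) :
  computable M -> computable (fun t => fsa_trans (M t)).
Proof. by move=> /computable_fsa_tuple cM; apply: (computable_snd cM). Qed.

Lemma computable_reduce (T : countType) (w : T -> seq (letter A)) :
  computable w -> computable (fun t => reduce (w t)).
Proof.
move=> cw; apply: (computable_foldr (f := fun _ => @push A)) cw; last first.
  exact: computable_const.
(* [push] without pattern matching: on the empty list [head] returns the letter itself, which
   differs from its inverse, so the test fails as it should. *)
apply: (computable_ext (f := fun c : T * letter A * seq (letter A) =>
    if head c.1.2 c.2 == linv c.1.2 then behead c.2 else c.1.2 :: c.2)).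
  case=> [[_ x] [|y s]] //=; by rewrite eq_sym (negPf (linv_neq x)).
have cid := computable_id (T * letter A * seq (letter A))%type.
have cx := computable_snd (computable_fst cid); have cs := computable_snd cid.
apply: computable_if (computable_behead cs) (computable_cons cx cs).
apply: computable_eq (computable_head cx cs) _.
exact: computable_comp (computable_finType _) cx.
Qed.

Lemma computable_fsa_acceptsb (T : countType) (M : T -> fsa A) (w : T -> seq (letter A)) :
  computable M -> computable w -> computable (fun t => fsa_acceptsb (M t) (w t)).
Proof.
apply: (computable_comp2 (f := @fsa_acceptsb A)).
apply: (computable_has (p := fun c p => p \in fsa_final c.1)).
  computability; apply: computable_fsa_final; computability.
apply: (computable_foldl (f := fun c => fsa_step c.1)); rewrite /fsa_step.
- computability; apply: computable_fsa_trans; computability.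
- apply: computable_fsa_init; computability.
- computability.
Qed.

End CheckerComputability.

Ltac checker_step := lazymatch goal with
  | |- computable (fun _ => comp_rel _ _) => apply: computable_comp_rel
  | |- computable (fun _ => sub_rel _ _) => apply: computable_sub_rel
  | |- computable (fun _ => links _ _ _) => apply: computable_links
  | |- computable (fun _ => label_rel _ _) => apply: computable_label_rel
  | |- computable (fun _ => linv _) => apply: computable_linv
  | |- computable (fun _ => fsa_init _) => apply: computable_fsa_init
  | |- computable (fun _ => fsa_final _) => apply: computable_fsa_final
  | |- computable (fun _ => fsa_trans _) => apply: computable_fsa_trans
  | |- computable (fun _ => fsa_acceptsb _ _) => apply: computable_fsa_acceptsb
  | |- computable (fun _ => reduce _) => apply: computable_reduce
  | |- _ => computability_step
  end.

Lemma computable_solves (A : finType) : computable (@solves A).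
Proof. by rewrite /solves; repeat checker_step. Qed.

Lemma computable_refuted (A : finType) : computable (@refuted A).
Proof.
(* Projections replace the tuple pattern, so that the body has a shape [checker_step] recognises. *)
have : computable (fun c : (fsa A * fsa A * fsa A) * certificate A =>
    let IF0 := tag_ends 0 c.1.1.1 in
    let IF1 := tag_ends 1 c.1.1.2 in
    let IF2 := tag_ends 2 c.1.2 in
    [&& all (fun p => p \in c.2.1.1.1.1)
          (IF0.1 ++ IF0.2 ++ IF1.1 ++ IF1.2 ++ IF2.1 ++ IF2.2),
        saturated (union_trans c.1) c.2.1.1.1.1 c.2.1.1.1.2 c.2.1.1.2,
        profiles_closed c.2.1.1.1.2 c.2.1.1.2 c.2.1.2
      & refutes c.2.1.1.1.2 c.2.1.2 c.2.2 IF0 IF1 IF2]).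
  rewrite /tag_ends /tag_states /saturated /union_trans /tag_trans.
  rewrite /profiles_closed /refutes /core_matches /conjugator_misses /=.
  by repeat checker_step.
by apply: computable_ext => -[M [[[[St E] D] X] Z]].
Qed.

Theorem corollary3p7 (A : finType) :
  decidable_problem (fun M : fsa A * fsa A * fsa A =>
    gen_conjugate (rational_subset M.1.1) (rational_subset M.1.2)
                  (rational_subset M.2)).
Proof.
have dstate : decodable state by apply: decodable_prod; apply: decodable_nat.
have dletter : decodable (letter A) := decodable_finType _.
have dpair := decodable_prod dstate dstate; have drel := decodable_seq dpair.
apply: (decidable_by_certificates _ _ (@computable_solves A)
  (@computable_refuted A) (@solvesP A) (@refutedP A)).
- have dw := decodable_seq dletter; exact: decodable_prod (decodable_prod dw dw) dw.
- apply: decodable_prod (decodable_seq drel).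
  apply: decodable_prod (decodable_seq (decodable_prod drel drel)).
  apply: decodable_prod (decodable_seq (decodable_prod dletter dpair)).
  exact: decodable_prod (decodable_seq dstate) drel.
Qed.
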